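(* Let $\psi$ be a nontrivial additive character of $\mathbb F_q$, and let $\eta=+1$ for the $+$ families and $\eta=-1$ for the $-$ families (with $n$ in the range where $DC_i^{\pm}(n,q)$ is defined). Then $$\sum_{w\in DC_i^{\pm}(n,q)}\psi(\mathrm{Tr}\,w)=\eta\,A_i^{\pm}(n,q)K(\psi;1)\quad(i=1,3),$$ $$\sum_{w\in DC_2^{\pm}(n,q)}\psi(\mathrm{Tr}\,w)=-\eta\,A_2^{\pm}(n,q)K(\psi;1)^2,$$ $$\sum_{w\in DC_4^{\pm}(n,q)}\psi(\mathrm{Tr}\,w)=-\eta\,q^{-1}A_4^{\pm}(n,q)K_{GL(2,q)}(\psi;1)=-\eta\,A_4^{\pm}(n,q)\bigl(K(\psi;1)^2+q^2-q\bigr).$$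
   Context: $q=3^s$. $K(\psi;a)=\sum_{\alpha\in\mathbb F_q^*}\psi(\alpha+a\alpha^{-1})$; $K_{GL(2,q)}(\psi;a)=\sum_{w\in GL(2,q)}\psi(\mathrm{Tr}\,w+a\,\mathrm{Tr}\,w^{-1})$. Fix a nonsquare $\epsilon\in\mathbb F_q^*$, $\delta_\epsilon=\mathrm{diag}(1,-\epsilon)$, $J=\begin{bmatrix}0&1_{n-1}&0\\1_{n-1}&0&0\\0&0&\delta_\epsilon\end{bmatrix}$, $O^-(2n,q)=\{w\in GL(2n,q):{}^twJw=J\}$, $SO^-$ its determinant-one subgroup. $Q=Q(2n,q)$: products $\begin{bmatrix}A&0&0\\0&{}^tA^{-1}&0\\0&0&i\end{bmatrix}\begin{bmatrix}1_{n-1}&B&-{}^th\delta_\epsilon\\0&1_{n-1}&0\\0&h&1_2\end{bmatrix}$, $A\in GL(n-1,q)$, $i\in SO^-(2,q)$, ${}^tB+B+{}^th\delta_\epsilon h=0$. $\rho=\mathrm{diag}(1_{n-1},1_{n-1},1,-1)$, $\sigma_r=\begin{bmatrix}0&0&1_r&0&0\\0&1_{n-1-r}&0&0&0\\1_r&0&0&0&0\\0&0&0&1_{n-1-r}&0\\0&0&0&0&1_2\end{bmatrix}$. $DC_1^+=Q\sigma_{n-1}Q$, $DC_2^+=Q\sigma_{n-2}Q$, $DC_3^+=\rho Q\sigma_{n-2}Q$ ($n\ge2$ even), $DC_4^+=\rho Q\sigma_{n-3}Q$ ($n\ge4$ even), $DC_1^-=Q\sigma_{n-1}Q$ ($n\ge1$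 odd), $DC_2^-=Q\sigma_{n-2}Q$, $DC_3^-=\rho Q\sigma_{n-2}Q$, $DC_4^-=\rho Q\sigma_{n-3}Q$ ($n\ge3$ odd), where $Q\sigma Q=\{x\sigma y\}$, $\rho Q\sigma Q=\{\rho x\sigma y\}$, $x,y\in Q$. Constants (empty products $=1$, $\left[{m\atop r}\right]_q=\prod_{j=0}^{r-1}\frac{q^{m-j}-1}{q^{r-j}-1}$): $A_1^+=q^{(5n^2-2n-4)/4}(q^{n-1}-1)\prod_{j=1}^{(n-2)/2}(q^{2j-1}-1)$; $A_2^+=q^{(5n^2-2n-8)/4}\left[{n-1\atop1}\right]_q\prod_{j=1}^{(n-2)/2}(q^{2j-1}-1)$; $A_3^+=(q+1)A_2^+$; $A_4^+=(q+1)q^{(5n^2-6n-4)/4}\left[{n-1\atop2}\right]_q\prod_{j=1}^{(n-2)/2}(q^{2j-1}-1)$; $A_1^-=q^{5(n^2-1)/4}\prod_{j=1}^{(n-1)/2}(q^{2j-1}-1)$; $A_2^-=q^{(5n^2-4n-5)/4}\left[{n-1\atop1}\right]_q\prod_{j=1}^{(n-1)/2}(q^{2j-1}-1)$; $A_3^-=(q+1)A_2^-$; $A_4^-=(q+1)q^{(5n^2-4n-9)/4}\left[{n-1\atop2}\right]_q\prod_{j=1}^{(n-3)/2}(q^{2j-1}-1)$ (all at $(n,q)$). *)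

(* Defs.v *)
From HB Require Import structures.
From mathcomp Require Import all_boot all_order all_algebra all_field.
Set Implicit Arguments. Unset Strict Implicit. Unset Printing Implicit Defensive.
Import Order.TTheory GRing.Theory Num.Theory.
Local Open Scope ring_scope.

Section Defs.
Variable F : finFieldType.

Definition dimn (n : nat) : nat := (n.-1 + n.-1 + 2)%N.

Definition diag2 (a b : F) : 'M[F]_2 :=
  \matrix_(i, j) (if i == j then (if (i : nat) == 0%N then a else b) else 0).

Definition delta (eps : F) : 'M[F]_2 := diag2 1 (- eps).

Definition SOm2 (eps : F) : {set 'M[F]_2} :=
  [set i : 'M[F]_2 | (i^T *m delta eps *m i == delta eps) && (\det i == 1)].

(* J and O^-(2n,q) (for reference; the double cosets only use Q, sigma, rho) *)
Definition Jmx (eps : F) (n : nat) : 'M[F]_(dimn n) :=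
  block_mx (block_mx 0 1%:M 1%:M 0) 0 0 (delta eps).
Definition Om (eps : F) (n : nat) : {set 'M[F]_(dimn n)} :=
  [set w | (w \in unitmx) && (w^T *m Jmx eps n *m w == Jmx eps n)].

Definition Qelt (eps : F) (m : nat) (A B : 'M[F]_m) (h : 'M[F]_(2, m))
    (i : 'M[F]_2) : 'M[F]_(m + m + 2) :=
  block_mx (block_mx A 0 0 (invmx A)^T) 0 0 i *m
  block_mx (block_mx 1%:M B 0 1%:M) (col_mx (- (h^T *m delta eps)) 0)
           (row_mx 0 h) 1%:M.

Definition Qset (eps : F) (n : nat) : {set 'M[F]_(dimn n)} :=
  [set w | [exists A : 'M[F]_(n.-1), exists B : 'M[F]_(n.-1),
            exists h : 'M[F]_(2, n.-1), exists i : 'M[F]_2,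
     [&& A \in unitmx, i \in SOm2 eps,
         B^T + B + h^T *m delta eps *m h == 0 &
         w == Qelt eps A B h i]]].

(* sigma_r, with blocks r, n-1-r, r, n-1-r, 2 *)
Definition sigma (n r : nat) : 'M[F]_(dimn n) :=
  \matrix_(i, j)
    (if [|| (((i : nat) < r)%N && ((j : nat) == i + n.-1)%N),
            (n.-1 <= i < n.-1 + r)%N && ((j : nat) + n.-1 == i)%N
          | (((r <= i < n.-1)%N || (n.-1 + r <= i)%N) && ((j : nat) == i))]
     then 1 else 0).

Definition rho (n : nat) : 'M[F]_(dimn n) :=
  block_mx 1%:M 0 0 (diag2 1 (-1)).

Definition QsQ (eps : F) (n r : nat) : {set 'M[F]_(dimn n)} :=
  [set x *m sigma n r *m y | x in Qset eps n, y in Qset eps n].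
Definition rQsQ (eps : F) (n r : nat) : {set 'M[F]_(dimn n)} :=
  [set rho n *m x *m sigma n r *m y | x in Qset eps n, y in Qset eps n].

Definition DC1 eps n := QsQ eps n n.-1.
Definition DC2 eps n := QsQ eps n (n - 2).
Definition DC3 eps n := rQsQ eps n (n - 2).
Definition DC4 eps n := rQsQ eps n (n - 3).

Definition Kl (psi : F -> algC) (a : F) : algC :=
  \sum_(x : F | x != 0) psi (x + a * x^-1).
Definition KGL (psi : F -> algC) (a : F) : algC :=
  \sum_(w : 'M[F]_2 | w \in unitmx) psi (\tr w + a * \tr (invmx w)).

Definition trsum (psi : F -> algC) (n : nat) (S : {set 'M[F]_(dimn n)}) : algC :=
  \sum_(w in S) psi (\tr w).

End Defs.

Definition qbin (q : algC) (m r : nat) : algC :=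
  \prod_(j < r) ((q ^+ (m - j) - 1) / (q ^+ (r - j) - 1)).

Definition oddprod (q : algC) (k : nat) : algC :=
  \prod_(1 <= j < k.+1) (q ^+ (2 * j - 1) - 1).

(* exponents: the nat divisions below are exact in the relevant ranges *)
Definition A1p (n : nat) (q : algC) : algC :=
  q ^+ ((5 * n ^ 2 - 2 * n - 4) %/ 4) * (q ^+ (n - 1) - 1) * oddprod q ((n - 2) %/ 2).
Definition A2p (n : nat) (q : algC) : algC :=
  q ^+ ((5 * n ^ 2 - 2 * n - 8) %/ 4) * qbin q (n - 1) 1 * oddprod q ((n - 2) %/ 2).
Definition A3p (n : nat) (q : algC) : algC := (q + 1) * A2p n q.
Definition A4p (n : nat) (q : algC) : algC :=
  (q + 1) * q ^+ ((5 * n ^ 2 - 6 * n - 4) %/ 4) * qbin q (n - 1) 2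
  * oddprod q ((n - 2) %/ 2).
Definition A1m (n : nat) (q : algC) : algC :=
  q ^+ ((5 * (n ^ 2 - 1)) %/ 4) * oddprod q ((n - 1) %/ 2).
Definition A2m (n : nat) (q : algC) : algC :=
  q ^+ ((5 * n ^ 2 - 4 * n - 5) %/ 4) * qbin q (n - 1) 1 * oddprod q ((n - 1) %/ 2).
Definition A3m (n : nat) (q : algC) : algC := (q + 1) * A2m n q.
Definition A4m (n : nat) (q : algC) : algC :=
  (q + 1) * q ^+ ((5 * n ^ 2 - 4 * n - 9) %/ 4) * qbin q (n - 1) 2
  * oddprod q ((n - 3) %/ 2).

(* Main.v *)
(* Since the trace is cyclic and rho normalizes Q, the sum over a double coset
   g Q sigma_r Q, with g = 1 or g = rho, is |Q : Q /\ sigma_r Q sigma_r^-1| times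
   the sum of psi (Tr (g x sigma_r)) over x in Q.  Put t = n - 1 - r and cut A, B, h
   along n - 1 = r + t.  Then Tr (g x sigma_r) is the sum of Tr (d i), Tr A22,
   Tr (A^-1)22 and Tr (A B)11, where d = 1 or d = diag(1,-1).  Summing over B kills all
   terms but those with A12 = 0 and A11 symmetric; the sum over h is then a product of
   norm form Gauss sums, equal to (-q)^r up to a power of q, and there remain the number
   of invertible symmetric r x r matrices, the Kloosterman sum over GL(t,q), and the sum
   over i in SO^-(2,q), which is -K for g = 1 and q + 1 for g = rho. *)
Require Import Defs.
From HB Require Import structures.
From mathcomp Require Import all_boot all_order all_algebra all_field.
From mathcomp Require Import ring zify.
Import Order.TTheory GRing.Theory Num.Theory.
Local Open Scope ring_scope.
Set Implicit Arguments. Unset Strict Implicit. Unset Printing Implicit Defensive.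

(** * Sums over matrices and additive characters *)

(** Scaling the binary norm form by a nonzero element leaves its Gauss sum at -q, so the sum over h
    takes the same value for every invertible symmetric A11. This is why nothing finer than a count
    of symmetric matrices is needed. SO^-(2,q) is the norm-one group of F_(q^2). Over each
    half-trace a, the conic eps c^2 = a^2 - 1 and the hyperbola y^2 = a^2 - 1 have two points
    together, and the hyperbola is parametrised by x + 1/x. The sum over i is therefore 2 * 0 - K.
    With rho the trace of d i vanishes and only the group order q + 1 is left. Signs: the h-sum
    gives (-1)^r with r = n - 1 - t, and the i-sum gives -1 for g = 1 and +1 for g = rho. As t is 0,
    1, 1, 2 for the four cosets, the products are eta, -eta, eta, -eta with eta = (-1)^n. Constants:
    |GL(n-1,q)| / (|GL(r,q)| |GL(t,q)|) is q^(rt) times the q-binomial of n - 1 over t, and the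
    products of q^(2j-1) - 1 come from the symmetric matrices, whose count depends on the parity of
    r. The remaining work is matching exponents, separately for even and odd n. *)

Lemma sum_translate_eq0 (T : finZmodType) (A : pred T) (g : T -> algC) x0 c :
    (forall x, A (x0 + x) = A x) -> (forall x, g (x0 + x) = c * g x) ->
  c != 1 -> \sum_(x | A x) g x = 0.
Proof.
move=> hA hg c1; set S := \sum_(x | _) _.
have: S = c * S.
  rewrite {1}/S (reindex_inj (addrI x0)) /= mulr_sumr.
  by apply: eq_big => x; rewrite ?hA ?hg.
move/eqP; rewrite -subr_eq0 -{1}[S]mul1r -mulrBl mulf_eq0 subr_eq0 eq_sym.
by rewrite (negPf c1) /= => /eqP.
Qed.

Lemma sum_block_mx (F : finFieldType) m1 m2 n1 n2
    (P : pred 'M[F]_(m1 + m2, n1 + n2)) (f : 'M[F]_(m1 + m2, n1 + n2) -> algC) :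
  \sum_(X | P X) f X =
  \sum_A \sum_B \sum_C \sum_(D | P (block_mx A B C D)) f (block_mx A B C D).
Proof.
rewrite (reindex (fun p : 'M_(m1, n1) * ('M_(m1, n2) * ('M_(m2, n1) * 'M_(m2, n2)))
  => block_mx p.1 p.2.1 p.2.2.1 p.2.2.2)) /=; last first.
  exists (fun X => (ulsubmx X, (ursubmx X, (dlsubmx X, drsubmx X)))) => [[A [B [C D]]]|X] _ /=.
    by rewrite block_mxKul block_mxKur block_mxKdl block_mxKdr.
  by rewrite submxK.
under [RHS]eq_bigr => A _ do under eq_bigr => B _ do
  rewrite (pair_big_dep xpredT (fun C D => P (block_mx A B C D))
    (fun C D => f (block_mx A B C D))) /=.
under [RHS]eq_bigr => A _ do rewrite (pair_big_dep xpredT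
  (fun B p => P (block_mx A B p.1 p.2)) (fun B p => f (block_mx A B p.1 p.2))) /=.
by rewrite (pair_big_dep xpredT (fun A p => P (block_mx A p.1 p.2.1 p.2.2))
  (fun A p => f (block_mx A p.1 p.2.1 p.2.2))).
Qed.

Lemma sum_row_mx (F : finFieldType) m n1 n2 (P : pred 'M[F]_(m, n1 + n2))
    (f : 'M[F]_(m, n1 + n2) -> algC) :
  \sum_(X | P X) f X = \sum_A \sum_(B | P (row_mx A B)) f (row_mx A B).
Proof.
rewrite (pair_big_dep xpredT (fun A B => P (row_mx A B))
  (fun A B => f (row_mx A B))) /=.
rewrite (reindex (fun p : 'M_(m, n1) * 'M_(m, n2) => row_mx p.1 p.2)) //=.
exists (fun X => (lsubmx X, rsubmx X)) => [[A B]|X] _ /=.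
  by rewrite row_mxKl row_mxKr.
by rewrite hsubmxK.
Qed.

Lemma sum_const_mx (F : finFieldType) m n (x : algC) :
  \sum_(X : 'M[F]_(m, n)) x = #|F|%:R ^+ (m * n) * x.
Proof. by rewrite sumr_const card_mx -natrX mulr_natl. Qed.

Lemma sum1_mx (F : finFieldType) m n :
  \sum_(X : 'M[F]_(m, n)) (1 : algC) = (#|F|%:R) ^+ (m * n).
Proof. by rewrite sum_const_mx mulr1. Qed.

Lemma mxtrace_mul_delta (R : comNzRingType) m n (M : 'M[R]_(m, n)) i j :
  \tr (M *m delta_mx j i) = M i j.
Proof.
rewrite /mxtrace (bigD1 i) //= mxE (bigD1 j) //= mxE !eqxx mulr1.
rewrite big1 => [|k kj]; last by rewrite mxE (negPf kj) mulr0.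
rewrite big1 => [|k ki]; first by rewrite !addr0.
by rewrite mxE big1 // => l _; rewrite mxE (negPf ki) andbF mulr0.
Qed.

Section AdditiveCharacter.
Variables (F : finFieldType) (psi : F -> algC).
Hypothesis psi0 : psi 0 = 1.
Hypothesis psiD : forall x y : F, psi (x + y) = psi x * psi y.
Hypothesis psi_nt : exists x : F, psi x != 1.
Local Notation q := (#|F|%:R : algC).

Lemma sum_char_scale (a : F) : \sum_(x : F) psi (a * x) = if a == 0 then q else 0.
Proof.
case: eqP => [->|/eqP a0].
  under eq_bigr do rewrite mul0r psi0.
  by rewrite sumr_const.
have [x0 hx0] := psi_nt.
apply: (@sum_translate_eq0 _ xpredT _ (a^-1 * x0) (psi x0)) => // x.
by rewrite mulrDr psiD mulrA divff // mul1r.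
Qed.

Lemma sum_char_mx m n (M : 'M[F]_(m, n)) :
  \sum_(X : 'M[F]_(n, m)) psi (\tr (M *m X)) = if M == 0 then q ^+ (n * m) else 0.
Proof.
case: eqP => [->|/eqP M0].
  under eq_bigr do rewrite mul0mx mxtrace0 psi0.
  exact: sum1_mx.
have /matrix0Pn[i [j Mij]] : M != 0 by [].
have [x0 hx0] := psi_nt.
(* Translating X by this multiple of an elementary matrix adds exactly [x0] to the trace. *)
apply: (@sum_translate_eq0 _ xpredT _ ((M i j)^-1 * x0 *: delta_mx j i) (psi x0)) => // x.
rewrite mulmxDr mxtraceD psiD -scalemxAr mxtraceZ; congr (psi _ * _).
by rewrite mxtrace_mul_delta mulrAC mulVf // mul1r.
Qed.
End AdditiveCharacter.

(** * Two by two matrices, SO^-(2,q) and Kloosterman sums *)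

Definition mx2 (R : Type) (a b c d : R) : 'M[R]_2 :=
  \matrix_(i, j) if i == 0 then (if j == 0 then a else b)
                 else (if j == 0 then c else d).

Lemma mx2P (R : Type) (A B : 'M[R]_2) :
  [/\ A 0 0 = B 0 0, A 0 1 = B 0 1, A 1 0 = B 1 0 & A 1 1 = B 1 1] -> A = B.
Proof.
case=> h00 h01 h10 h11; apply/matrixP => i j.
have ord2 (k : 'I_2) : k = 0 \/ k = 1.
  by case: k => [[|[|//]] hk]; [left|right]; apply/val_inj.
by case: (ord2 i) => ->; case: (ord2 j) => ->.
Qed.

Lemma mx2_eta (R : Type) (A : 'M[R]_2) : A = mx2 (A 0 0) (A 0 1) (A 1 0) (A 1 1).
Proof. by apply: mx2P; rewrite !mxE. Qed.

Lemma mul_mx2 (R : pzSemiRingType) (a b c d a' b' c' d' : R) :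
  mx2 a b c d *m mx2 a' b' c' d' =
  mx2 (a * a' + b * c') (a * b' + b * d') (c * a' + d * c') (c * b' + d * d').
Proof. by apply: mx2P; rewrite !mxE !big_ord_recl !big_ord0 !mxE /= !addr0. Qed.

Lemma tr_mx2 (R : Type) (a b c d : R) : (mx2 a b c d)^T = mx2 a c b d.
Proof. by apply: mx2P; rewrite !mxE. Qed.

Lemma mxtrace_mx2 (R : pzSemiRingType) (a b c d : R) : \tr (mx2 a b c d) = a + d.
Proof. by rewrite /mxtrace !big_ord_recl big_ord0 !mxE /= addr0. Qed.

Lemma det_mx2 (R : comPzRingType) (a b c d : R) : \det (mx2 a b c d) = a * d - b * c.
Proof.
rewrite (expand_det_row _ 0) !big_ord_recl big_ord0 /cofactor !det_mx11 !mxE /=.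
by rewrite addr0 expr0 expr1 mul1r mulN1r mulrN.
Qed.

Lemma mx2_1 (R : pzSemiRingType) : mx2 1 0 0 1 = 1%:M :> 'M[R]_2.
Proof. by apply: mx2P; rewrite !mxE. Qed.

Lemma invmx_mx2 (R : fieldType) (a b c d : R) : a * d - b * c != 0 ->
  let D := (a * d - b * c)^-1 in
  invmx (mx2 a b c d) = mx2 (d * D) (- b * D) (- c * D) (a * D).
Proof.
move=> D0 D.
have u : mx2 a b c d \in unitmx by rewrite unitmxE det_mx2 unitfE.
rewrite -[RHS]mul1mx -(mulVmx u) -mulmxA mul_mx2 -[LHS]mulmx1 -mx2_1.
by congr (_ *m mx2 _ _ _ _); rewrite /D; field.
Qed.

(** The order of the entries is chosen for its uses: the Bruhat cells are separated by [c], so [c]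
    is outermost; [b] is determined by [c] on SO^-(2,q), and by the determinant when [c] is nonzero,
    so [b] is innermost. *)
Lemma sum_mx2 (F : finFieldType) (P : pred 'M[F]_2) (f : 'M[F]_2 -> algC) :
  \sum_(X | P X) f X =
  \sum_c \sum_a \sum_d \sum_(b | P (mx2 a b c d)) f (mx2 a b c d).
Proof.
rewrite (reindex (fun p : F * (F * (F * F)) => mx2 p.2.1 p.2.2.2 p.1 p.2.2.1)) /=;
  last first.
  exists (fun X : 'M_2 => (X 1 0, (X 0 0, (X 1 1, X 0 1)))) => [[c [a [d b]]]|X] _ /=.
    by rewrite !mxE.
  by rewrite -mx2_eta.
under [RHS]eq_bigr => c _ do under eq_bigr => a _ do
  rewrite (pair_big_dep xpredT (fun d b => P (mx2 a b c d))
    (fun d b => f (mx2 a b c d))) /=.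
under [RHS]eq_bigr => c _ do rewrite (pair_big_dep xpredT
  (fun a p => P (mx2 a p.2 c p.1)) (fun a p => f (mx2 a p.2 c p.1))) /=.
by rewrite (pair_big_dep xpredT (fun c p => P (mx2 p.1 p.2.2 c p.2.1))
  (fun c p => f (mx2 p.1 p.2.2 c p.2.1))).
Qed.

Section NormForm.
Variables (F : finFieldType) (eps : F).
Hypothesis two_neq0 : 2%:R != 0 :> F.
Hypothesis eps_nonsquare : forall x : F, x * x != eps.

Let roots (e c : F) := #|[pred y : F | e * y ^+ 2 == c]|.

Lemma card_sqrt_le2 (e c : F) : e != 0 -> c != 0 -> (roots e c <= 2)%N.
Proof.
move=> e0 c0; case: (pickP [pred y | e * y ^+ 2 == c]) => [y0 /= /eqP hy0|h0]; last first.
  by rewrite /roots eq_card0 // => i; rewrite h0.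
rewrite (leq_trans (subset_leq_card (_ : _ \subset [:: y0; - y0]))) ?card_size //.
apply/subsetP => y; rewrite !inE => /eqP hy.
rewrite -eqf_sqr -subr_eq0; apply/eqP/(mulfI e0).
by rewrite mulr0 mulrBr hy hy0 subrr.
Qed.

(* The left side is at most 2 for every c and has average 2. *)
Lemma card_sqrt (c : F) : (roots 1%R c + roots eps c = 2)%N.
Proof.
have eps0 : eps != 0 by have := eps_nonsquare 0; rewrite mul0r eq_sym.
pose f c := (roots 1%R c + roots eps c)%N.
have fle d : (f d <= 2)%N.
  have [->|d0] := eqVneq d 0.
    have r0 e : e != 0 -> roots e 0 = 1%N.
      move=> e0; apply: (@eq_card1 _ 0) => y.
      by rewrite !inE mulf_eq0 (negPf e0) sqrf_eq0.
    by rewrite /f !r0 ?oner_eq0.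
  have [y /= /eqP hy|h] := pickP [pred y : F | 1 * y ^+ 2 == d].
    rewrite /f [X in (_ + X)%N]eq_card0 ?addn0 => [|z].
      by apply: card_sqrt_le2; rewrite ?oner_eq0.
    rewrite !inE; apply/negP => /eqP hz.
    have z0 : z != 0 by apply: contraNneq d0 => z0; rewrite -hz z0 expr0n mulr0.
    (* A nonzero [d] cannot be both y^2 and eps z^2, since y / z would be a square root of [eps]. *)
    case/eqP: (eps_nonsquare (y / z)).
    by rewrite mulrACA -invfM -!expr2 -[y ^+ 2]mul1r hy -hz mulfK // sqrf_eq0.
  by rewrite /f [X in (X + _)%N]eq_card0 ?add0n ?card_sqrt_le2.
have Sr e : (\sum_d roots e d = \sum_(d : F) 1)%N.
  rewrite [RHS](partition_big (fun y => e * y ^+ 2) xpredT) //=.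
  by apply: eq_bigr => d _; rewrite /roots -sum1_card; apply: eq_bigl.
have Sf : (\sum_d f d = \sum_(d : F) 2)%N by rewrite big_split /= !Sr -big_split.
apply/eqP; rewrite eqn_leq fle /= leqNgt; apply/negP => flt.
move/eqP: Sf; apply/negP; rewrite neq_ltn (bigD1 c) //= [X in (_ < X)%N](bigD1 c) //=.
by rewrite -addSn leq_add // leq_sum.
Qed.

(** The maps y -> y^2 and y -> eps y^2 together hit every element exactly twice. *)
Lemma sum_sqrt (g : F -> algC) :
  \sum_y g (y ^+ 2) + \sum_y g (eps * y ^+ 2) = 2%:R * \sum_c g c.
Proof.
rewrite (partition_big (fun y => 1 * y ^+ 2) xpredT) //=.
rewrite [X in _ + X](partition_big (fun y => eps * y ^+ 2) xpredT) //=.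
rewrite -big_split mulr_sumr; apply: eq_bigr => c _ /=.
rewrite (eq_bigr (fun=> g c)) => [|y /eqP <-]; last by rewrite mul1r.
rewrite [X in _ + X](eq_bigr (fun=> g c)) => [|y /eqP ->//].
by rewrite !sumr_const -mulrnDr mulr_natl -[in RHS](card_sqrt c).
Qed.

Lemma delta_mx2 : delta eps = mx2 1 0 0 (- eps).
Proof. by apply: mx2P; rewrite !mxE. Qed.

(** These are the matrices of multiplication by a + c sqrt(eps) in the basis 1, sqrt(eps) of
    F_(q^2), restricted to norm one. *)
Lemma SOm2P a b c d : (mx2 a b c d \in SOm2 eps) =
  [&& b == eps * c, d == a & a ^+ 2 - eps * c ^+ 2 == 1].
Proof.
rewrite inE delta_mx2 tr_mx2 !mul_mx2 det_mx2; apply/andP/and3P.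
  case=> /eqP/matrixP h /eqP hd.
  have := h 0 0; have := h 0 1; rewrite !mxE /= => h01 h00.
  have e1 : a ^+ 2 - eps * c ^+ 2 = 1 by rewrite -h00; ring.
  have e2 : a * b = eps * c * d by apply/eqP; rewrite -subr_eq0 -h01; apply/eqP; ring.
  split; apply/eqP => //.
    (* Multiply b by a^2 - eps c^2 = 1; the relation a b = eps c d turns the product into eps c
       times the determinant. The entry d is treated in the same way. *)
    rewrite -[b]mulr1 -e1 -[RHS]mulr1 -hd.
    transitivity (a * (a * b) - b * (eps * c ^+ 2)); first by ring.
    by rewrite e2; ring.
  rewrite -[d]mulr1 -e1 -[RHS]mulr1 -hd.
  transitivity (a ^+ 2 * d - c * (eps * c * d)); first by ring.
  by rewrite -e2; ring.
case=> /eqP -> /eqP -> /eqP h; split; apply/eqP; last by rewrite -h; ring.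
have e : eps * a ^+ 2 - eps * (eps * c ^+ 2) = eps by rewrite -mulrBr h mulr1.
apply: mx2P; rewrite !mxE /=; split; first by rewrite -[RHS]h; ring.
- by ring.
- by ring.
by rewrite -[RHS]opprK -[in RHS]e; ring.
Qed.

Lemma half_addK (x : F) : 2%:R^-1 * x + 2%:R^-1 * x = x.
Proof. by field. Qed.

(* The substitution x = a + y, x^-1 = a - y. *)
Lemma sum_hyperbola (g : F -> algC) :
  \sum_a \sum_(y | y ^+ 2 == a ^+ 2 - 1) g (a *+ 2) = \sum_(x | x != 0) g (x + x^-1).
Proof.
rewrite (pair_big_dep xpredT (fun a y => y ^+ 2 == a ^+ 2 - 1) (fun a y => g (a *+ 2))) /=.
rewrite (reindex (fun x => (2%:R^-1 * (x + x^-1), 2%:R^-1 * (x - x^-1)))) /=.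
  apply: eq_big => x /= => [|_]; last by rewrite -[X in g X = _]mulr_natl mulVKf.
  rewrite -subr_eq0 !expr2.
  have -> : 2%:R^-1 * (x - x^-1) * (2%:R^-1 * (x - x^-1)) -
    (2%:R^-1 * (x + x^-1) * (2%:R^-1 * (x + x^-1)) - 1) = 1 - x * x^-1.
    by set y := x^-1; field.
  have [->|x0] := eqVneq x 0; first by rewrite mul0r subr0 oner_eq0.
  by rewrite divff // subrr eqxx.
exists (fun p => p.1 + p.2) => [x _|[a y]] /=; rewrite ?inE /=.
  by rewrite -mulrDr addrACA subrr addr0 mulrDr half_addK.
move=> /eqP h; have e : (a + y) * (a - y) = 1.
  by rewrite mulrC -subr_sqr h opprB addrCA subrr addr0.
have i : (a + y)^-1 = a - y.
  have h0 : a + y != 0 by apply: contra_eq_neq e => ->; rewrite mul0r eq_sym oner_eq0.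
  by rewrite -[LHS]mulr1 -e mulKf.
by rewrite i; congr (_, _); field.
Qed.

(** For fixed a, the solutions of eps c^2 = a^2 - 1 and of y^2 = a^2 - 1 number two in all by
    [card_sqrt]. Adding the hyperbola sum thus gives twice the sum of g (2 a), where 2 a runs
    through the field. *)
Lemma sum_SOm2_tr (g : F -> algC) :
  \sum_(i in SOm2 eps) g (\tr i) =
  2%:R * \sum_t g t - \sum_(x | x != 0) g (x + x^-1).
Proof.
rewrite -sum_hyperbola sum_mx2.
under eq_bigr => c _ do under eq_bigr => a _ do under eq_bigr => d _ do
  under eq_bigr => b _ do rewrite mxtrace_mx2.
have -> : \sum_c \sum_a \sum_d \sum_(b | mx2 a b c d \in SOm2 eps) g (a + d) =
  \sum_a \sum_(c | eps * c ^+ 2 == a ^+ 2 - 1) g (a *+ 2).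
  rewrite exchange_big; apply: eq_bigr => a _ /=.
  rewrite [RHS]big_mkcond; apply: eq_bigr => c _ /=.
  rewrite (bigD1 a) //= [X in _ + X]big1 ?addr0 => [|d da]; last first.
    by rewrite big1 // => b; rewrite SOm2P (negPf da) andbF.
  under eq_bigl do rewrite SOm2P eqxx /=.
  have -> : (eps * c ^+ 2 == a ^+ 2 - 1) = (a ^+ 2 - eps * c ^+ 2 == 1).
    by rewrite [RHS]subr_eq eq_sym subr_eq addrC.
  case: eqP => h; last by rewrite big1 // => b; rewrite andbF.
  by rewrite (big_pred1 (eps * c)) ?mulr2n // => b; rewrite /= andbT.
apply/eqP; rewrite eq_sym subr_eq eq_sym -big_split /=; apply/eqP.
transitivity (\sum_(a : F) 2%:R * g (a *+ 2)).
  apply: eq_bigr => a _; rewrite !sumr_const -mulrnDr mulr_natl; congr (_ *+ _).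
  rewrite -[RHS](card_sqrt (a ^+ 2 - 1)) addnC; congr addn.
  by apply: eq_card => y; rewrite !inE mul1r.
rewrite -mulr_sumr; congr (_ * _).
rewrite [RHS](reindex (fun a => a *+ 2)) //.
exists (fun a => 2%:R^-1 * a) => a _ /=; last by rewrite -mulrnAr -[a *+ 2]mulr_natl mulKf.
by rewrite -[a *+ 2]mulr_natl mulKf.
Qed.

Section Psi.
Variable psi : F -> algC.
Hypothesis psi0 : psi 0 = 1.
Hypothesis psiD : forall x y : F, psi (x + y) = psi x * psi y.
Hypothesis psi_nt : exists x : F, psi x != 1.
Local Notation q := (#|F|%:R : algC).

Lemma psi_sum0 : \sum_x psi x = 0.
Proof.
transitivity (\sum_x psi (1 * x)); first by apply: eq_bigr => x _; rewrite mul1r.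
by rewrite (sum_char_scale psi0 psiD psi_nt) oner_eq0.
Qed.

Lemma sum_psi_SOm2 : \sum_(i in SOm2 eps) psi (\tr i) = - Kl psi 1.
Proof.
rewrite sum_SOm2_tr psi_sum0 mulr0 add0r /Kl.
by congr (- _); apply: eq_bigr => x _; rewrite mul1r.
Qed.

Lemma sum1_neq0 : \sum_(x : F | x != 0) (1 : algC) = q - 1.
Proof.
have -> : q = \sum_(x : F) 1 by rewrite sumr_const.
by rewrite [in RHS](bigD1 0) //= [RHS]addrC addKr.
Qed.

Lemma card_SOm2 : \sum_(i in SOm2 eps) (1 : algC) = q + 1.
Proof.
rewrite (sum_SOm2_tr (fun=> 1)) sum1_neq0 sumr_const; ring.
Qed.

(** The diagonal entries of [i] agree and the last one changes sign. For the cosets with rho this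
    makes every term of the sum over SO^-(2,q) equal to 1. *)
Lemma tr_diag_SOm2 i : i \in SOm2 eps -> \tr (diag2 1 (-1) *m i) = 0.
Proof.
rewrite [i]mx2_eta SOm2P => /and3P[_ /eqP-> _].
have -> : diag2 1 (-1) = mx2 1 0 0 (-1) :> 'M[F]_2 by apply: mx2P; rewrite !mxE.
by rewrite mul_mx2 mxtrace_mx2; ring.
Qed.

(* The Gauss sums attached to a and to eps * a are opposite, so the binary norm
   form has the opposite sum of the hyperbolic plane. *)
Lemma sum_psi_norm_form (a : F) : a != 0 ->
  \sum_x \sum_y psi (a * (x ^+ 2 - eps * y ^+ 2)) = - q.
Proof.
move=> a0; pose G c := \sum_x psi (c * x ^+ 2).
have GN c : c != 0 -> G (c * eps) = - G c.
  move=> c0; apply/eqP; rewrite -addr_eq0 addrC /G; apply/eqP.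
  under [X in _ + X]eq_bigr do rewrite -mulrA.
  rewrite (sum_sqrt (fun x => psi (c * x))).
  by rewrite (sum_char_scale psi0 psiD psi_nt) (negPf c0) mulr0.
have split_sum c d : \sum_x \sum_y psi (c * x ^+ 2 + d * y ^+ 2) = G c * G d.
  rewrite /G mulr_suml; apply: eq_bigr => x _.
  by rewrite mulr_sumr; apply: eq_bigr => y _; rewrite psiD.
transitivity (\sum_x \sum_y psi (a * x ^+ 2 + (- a * eps) * y ^+ 2)).
  by apply: eq_bigr => x _; apply: eq_bigr => y _; congr psi; ring.
(* [GN] at -a trades the coefficient -a eps for -a at the price of a sign; what remains is the
   hyperbolic form a (x^2 - y^2). *)
rewrite split_sum GN ?oppr_eq0 // mulrN -split_sum; congr (- _).
rewrite pair_big /=.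
(* The coordinates u = x + y and v = x - y turn the form into a u v, whose sum over v vanishes
   unless u = 0. *)
rewrite (reindex (fun p : F * F => (2%:R^-1 * (p.1 + p.2), 2%:R^-1 * (p.1 - p.2)))) /=;
  last first.
  exists (fun p => (p.1 + p.2, p.1 - p.2)) => [[u v]|[x y]] _ /=; congr (_, _); by field.
rewrite -(pair_big xpredT xpredT (fun u v =>
  psi (a * (2%:R^-1 * (u + v)) ^+ 2 + - a * (2%:R^-1 * (u - v)) ^+ 2))) /=.
transitivity (\sum_u \sum_v psi (a * u * v)).
  by apply: eq_bigr => u _; apply: eq_bigr => v _; congr psi; field.
rewrite (bigD1 0) //= [X in _ + X]big1 ?addr0 => [|u u0].
  by rewrite (sum_char_scale psi0 psiD psi_nt) mulr0 eqxx.
by rewrite (sum_char_scale psi0 psiD psi_nt) mulf_eq0 (negPf a0) (negPf u0).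
Qed.

(* Bruhat decomposition: lower left entry zero or not. *)
Lemma KGL2 : KGL psi 1 = q * Kl psi 1 ^+ 2 + q ^+ 3 - q ^+ 2.
Proof.
rewrite /KGL sum_mx2 (bigD1 0) //=.
have unitE (a b c d : F) : (mx2 a b c d \in unitmx) = (a * d - b * c != 0).
  by rewrite unitmxE det_mx2 unitfE.
have -> : \sum_a \sum_d \sum_(b | mx2 a b 0 d \in unitmx)
    psi (\tr (mx2 a b 0 d) + 1 * \tr (invmx (mx2 a b 0 d))) = q * Kl psi 1 ^+ 2.
  transitivity (\sum_(a | a != 0) \sum_(d : F | d != 0)
      q * (psi (a + 1 * a^-1) * psi (d + 1 * d^-1))).
    rewrite [RHS]big_mkcond; apply: eq_bigr => a _ /=.
    case: ifPn => [a0|/negPn/eqP->]; last first.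
      rewrite big1 // => d _; rewrite big_pred0 // => b.
      by rewrite unitE mul0r mulr0 subrr eqxx.
    rewrite [RHS]big_mkcond; apply: eq_bigr => d _ /=.
    case: ifPn => [d0|/negPn/eqP->]; last first.
      by rewrite big_pred0 // => b; rewrite unitE !mulr0 subrr eqxx.
    rewrite mulr_natl -sumr_const; apply: eq_big => b.
      by rewrite unitE mulr0 subr0 mulf_eq0 (negPf a0) (negPf d0).
    move=> h; rewrite invmx_mx2 ?mulr0 ?subr0 ?mulf_neq0 // !mxtrace_mx2 -psiD.
    by congr psi; field; rewrite a0 d0.
  rewrite expr2 /Kl mulr_suml mulr_sumr; apply: eq_bigr => a _.
  by rewrite mulr_sumr mulr_sumr; apply: eq_bigr.
rewrite -addrA; congr (_ + _).
(* In the big cell every nonzero c contributes q^2, so the cell gives q^3 - q^2. *)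
transitivity (\sum_(c : F | c != 0) q ^+ 2); last first.
  by rewrite -(mulr1 (q ^+ 2)) -mulr_sumr sum1_neq0; ring.
apply: eq_bigr => c c0.
transitivity (\sum_a \sum_d \sum_(e | e != 0) psi (a * (1 + e^-1)) * psi (d * (1 + e^-1))).
  apply: eq_bigr => a _; apply: eq_bigr => d _.
  (* For nonzero c the determinant e replaces b as a variable. The inverse has trace (a + d) / e, so
     the argument of [psi] becomes (a + d)(1 + 1/e), and only e = -1 survives the sums over a and
     d. *)
  rewrite (reindex (fun e => (a * d - e) / c)) /=; last first.
    exists (fun b => a * d - b * c) => e _ /=; first by rewrite divfK // subKr.
    by rewrite subKr mulfK.
  apply: eq_big => e; first by rewrite unitE divfK // subKr.
  rewrite unitE divfK // subKr => e0.
  rewrite invmx_mx2 divfK // subKr // !mxtrace_mx2 -psiD; congr psi; ring.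
transitivity (\sum_(e | e != 0) (\sum_a psi (a * (1 + e^-1))) ^+ 2).
  under eq_bigr do rewrite exchange_big.
  rewrite exchange_big; apply: eq_bigr => e _.
  rewrite expr2 mulr_suml; apply: eq_bigr => a _.
  by rewrite mulr_sumr.
have S e : \sum_a psi (a * (1 + e^-1)) = if e == -1 then q else 0.
  under eq_bigr do rewrite mulrC.
  rewrite (sum_char_scale psi0 psiD psi_nt) addrC addr_eq0.
  by rewrite -(inj_eq (@invr_inj F)) invrN1 invrK.
under eq_bigr do rewrite S.
rewrite (bigD1 (-1)) ?oppr_eq0 ?oner_eq0 //= eqxx big1 ?addr0 // => e /andP[_ /negPf ->].
by rewrite expr0n.
Qed.
End Psi.
End NormForm.

(** * Counting invertible, alternating and symmetric matrices *)

Lemma eq_block_mxE (R : eqType) m1 m2 n1 n2 (A A' : 'M[R]_(m1, n1)) (B B' : 'M_(m1, n2))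
    (C C' : 'M_(m2, n1)) (D D' : 'M_(m2, n2)) :
  (block_mx A B C D == block_mx A' B' C' D') = [&& A == A', B == B', C == C' & D == D'].
Proof.
apply/eqP/and4P => [/eq_block_mx[-> -> -> ->]|[/eqP-> /eqP-> /eqP-> /eqP->]] //.
Qed.

Lemma unitmx_schur (R : comUnitRingType) m n (A : 'M[R]_m) B C (D : 'M_n) : A \in unitmx ->
  (block_mx A B C D \in unitmx) = (D - C *m invmx A *m B \in unitmx).
Proof.
move=> uA; have -> : block_mx A B C D =
    block_mx 1%:M 0 (C *m invmx A) 1%:M *m block_mx A B 0 (D - C *m invmx A *m B).
  rewrite mulmx_block !mul1mx !mul0mx !addr0 mulmxKV //.
  by rewrite addrC subrK.
rewrite unitmx_mul [X in X && _]unitmxE det_lblock !det1 mulr1 unitr1 /=.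
by rewrite unitmxE det_ublock unitrM -!unitmxE uA.
Qed.

Section Counting.
Variable F : finFieldType.
Local Notation q := (#|F|%:R : algC).

Definition unit_count m : algC := \sum_(A : 'M[F]_m | A \in unitmx) 1.
(* The diagonal of B^T + B is twice that of B, so in odd characteristic these are
   the alternating matrices. *)
Definition alt_count m : algC := \sum_(B : 'M[F]_m | B^T + B == 0) 1.
Definition sym_count m : algC := \sum_(S : 'M[F]_m | (S^T == S) && (S \in unitmx)) 1.

Lemma sum1_mx_neq0 m n : \sum_(X : 'M[F]_(m, n) | X != 0) (1 : algC) = q ^+ (m * n) - 1.
Proof. by rewrite -sum1_mx [in RHS](bigD1 0) //= [RHS]addrC addKr. Qed.

Lemma eq_mx0 n (A B : 'M[F]_(0, n)) : A = B.
Proof. by apply/matrixP => [[]]. Qed.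

Lemma sum_mx0 n (P : pred 'M[F]_(0, n)) (f : 'M[F]_(0, n) -> algC) :
  P 0 -> \sum_(A | P A) f A = f 0.
Proof.
by move=> P0; rewrite (big_pred1 0) // => A; rewrite (eq_mx0 A 0) /= eqxx.
Qed.

Lemma unit_countE m : unit_count m = q ^+ 'C(m, 2) * \prod_(1 <= i < m.+1) (q ^+ i - 1).
Proof.
case: m => [|m]; first by rewrite /unit_count sum_mx0 ?big_geq ?mulr1 // unitmxE det_mx00 unitr1.
have -> : unit_count m.+1 = #|'GL_m.+1[F]%g|%:R.
  rewrite /unit_count sumr_const cardsT /= card_sub; congr (_%:R).
rewrite card_GL // natrM natrX natr_prod; congr (_ * _).
apply: eq_bigr => i _; rewrite natrB ?natrX // expn_gt0.
by rewrite (ltn_trans _ (finNzRing_gt1 F)).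
Qed.

Lemma unit_count_neq0 m : unit_count m != 0.
Proof.
rewrite /unit_count sumr_const pnatr_eq0 -lt0n; apply/card_gt0P; exists 1%:M.
exact: unitmx1.
Qed.

Lemma unit_count0 : unit_count 0 = 1.
Proof. by rewrite unit_countE big_geq // mulr1. Qed.

Lemma unit_countS m : unit_count m.+1 = q ^+ m * (q ^+ m.+1 - 1) * unit_count m.
Proof. by rewrite !unit_countE big_nat_recr //= binS bin1 exprD; ring. Qed.

(** The two off-diagonal equations are transposes of each other: B21 is free and determines B12,
    while each diagonal block satisfies an equation of the original type. The blocks C will be those
    of [h^T *m delta eps *m h]. *)
Lemma sum_alternating_block r t C11 C12 C22 (f : 'M[F]_(r + t) -> algC) :
  \sum_(B | B^T + B + block_mx C11 C12 C12^T C22 == 0) f B =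
  \sum_(B11 | B11^T + B11 + C11 == 0) \sum_B21
    \sum_(B22 | B22^T + B22 + C22 == 0) f (block_mx B11 (- (B21^T + C12)) B21 B22).
Proof.
rewrite sum_block_mx [RHS]big_mkcond; apply: eq_bigr => B11 _ /=.
have condE B12 B21 B22 : ((block_mx B11 B12 B21 B22)^T + block_mx B11 B12 B21 B22 +
      block_mx C11 C12 C12^T C22 == 0) =
    [&& B11^T + B11 + C11 == 0, B12 == - (B21^T + C12) & B22^T + B22 + C22 == 0].
  rewrite tr_block_mx !add_block_mx block_mx_eq0; congr (_ && _).
  have -> : (B21^T + B12 + C12 == 0) = (B12 == - (B21^T + C12)).
    by rewrite -[RHS]addr_eq0 addrCA addrA.
  have -> : (B12^T + B21 + C12^T == 0) = (B12 == - (B21^T + C12)).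
    rewrite -[LHS](inj_eq (@trmx_inj _ _ _)) trmx0 -[RHS]addr_eq0.
    by rewrite !raddfD /= !trmxK addrA.
  by rewrite andbA andbb.
case: ifP => h11; last first.
  by rewrite big1 // => B12 _; rewrite big1 // => B21 _; rewrite big_pred0 // => B22;
    rewrite condE h11.
rewrite exchange_big; apply: eq_bigr => B21 _ /=.
rewrite (bigD1 (- (B21^T + C12))) //= [X in _ + X]big1 ?addr0 => [|B12 /negPf h12].
  by apply: eq_bigl => B22; rewrite condE h11 eqxx.
by rewrite big_pred0 // => B22; rewrite condE h11 h12.
Qed.

Lemma sum_sym_block r t (P : pred 'M[F]_(r + t)) (f : 'M[F]_(r + t) -> algC) :
  \sum_(S | (S^T == S) && P S) f S =
  \sum_(A | A^T == A) \sum_B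
    \sum_(D | (D^T == D) && P (block_mx A B B^T D)) f (block_mx A B B^T D).
Proof.
rewrite sum_block_mx [RHS]big_mkcond; apply: eq_bigr => A _ /=.
have condE B C D : ((block_mx A B C D)^T == block_mx A B C D) =
    [&& A^T == A, C == B^T & D^T == D].
  rewrite tr_block_mx eq_block_mxE; congr (_ && _); rewrite andbA; congr (_ && _).
  by rewrite -[C^T == B](inj_eq (@trmx_inj _ _ _)) trmxK [B^T == C]eq_sym andbb.
case: ifP => hA; last first.
  by rewrite big1 // => B _; rewrite big1 // => C _; rewrite big_pred0 // => D;
    rewrite condE hA.
apply: eq_bigr => B _.
rewrite (bigD1 B^T) //= [X in _ + X]big1 ?addr0 => [|C /negPf hC].
  by apply: eq_bigl => D; rewrite condE hA eqxx.
by rewrite big_pred0 // => D; rewrite condE hA hC.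
Qed.

Lemma alt_countD r t : alt_count (r + t) = q ^+ (t * r) * alt_count r * alt_count t.
Proof.
rewrite /alt_count.
transitivity (\sum_(B : 'M[F]_(r + t) |
    B^T + B + block_mx 0 (0 : 'M_(r, t)) (0 : 'M_(r, t))^T 0 == 0) (1 : algC)).
  by apply: eq_bigl => B; rewrite trmx0 block_mx0 addr0.
rewrite sum_alternating_block.
rewrite -mulrA mulr_suml mulr_sumr; apply: eq_big => A; first by rewrite addr0.
rewrite mul1r => _; rewrite -natrX mulr_natl -card_mx -sumr_const; apply: eq_bigr => B _.
by apply: eq_bigl => D; rewrite addr0.
Qed.

Lemma alt_count0 : alt_count 0 = 1.
Proof. by rewrite /alt_count sum_mx0 // trmx0 addr0. Qed.

Section OddCharacteristic.
Hypothesis two_neq0 : 2%:R != 0 :> F.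

Lemma alt_count1 : alt_count 1 = 1.
Proof.
rewrite /alt_count (big_pred1 0) // => B; have -> : B^T = B.
  by apply/matrixP => i j; rewrite mxE !ord1.
by rewrite -mulr2n -scaler_nat scaler_eq0 (negPf two_neq0).
Qed.

Lemma alt_countE m : alt_count m = q ^+ 'C(m, 2).
Proof.
elim: m => [|m IH]; first exact: alt_count0.
by rewrite -[in LHS]add1n alt_countD alt_count1 mulr1 muln1 IH binS bin1 exprD mulrC.
Qed.

(** For symmetric C the matrix -C/2 is a particular solution; translating by it leaves the
    homogeneous equation. *)
Lemma sum_alternating_coset m (C : 'M[F]_m) : C^T = C ->
  \sum_(B : 'M[F]_m | B^T + B + C == 0) (1 : algC) = alt_count m.
Proof.
move=> hC; rewrite (reindex_inj (addrI (- (2%:R^-1 *: C)))) /=; apply: eq_bigl => B.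
rewrite raddfD raddfN /= linearZ /= hC addrACA.
rewrite -opprD -scalerDl -[X in X + X]mul1r -mulrDl divff // scale1r.
by rewrite addrAC addNr add0r.
Qed.

(** Rank normal form of a row: its column factor is a 1 by 1 scalar and is absorbed into the
    invertible row factor. *)
Lemma row_mulmx_unit (k : nat) (v : 'rV[F]_(1 + k)) : v != 0 ->
  exists2 P : 'M[F]_(1 + k), P \in unitmx & v = row_mx 1%:M 0 *m P.
Proof.
move=> v0; have := mulmx_ebase v; rewrite rank_rV v0 pid_mx_row.
set c := col_ebase v => h; exists (c 0 0 *: row_ebase v).
  rewrite unitmxZ ?row_ebase_unit //.
  by have := col_ebase_unit v; rewrite unitmxE [col_ebase v]mx11_scalar det_scalar1.
by rewrite -[LHS]h {1}[c]mx11_scalar -mulmxA mul_scalar_mx scalemxAr.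
Qed.

(** The corner and the first row form a hyperbolic plane that clears s and u whatever their values.
    For invertible T the inverse is written down explicitly; conversely, the upper right block of M
    N = 1 kills the first row of the lower right block of N, and the last block of the equation then
    inverts T. *)
Lemma unitmx_hyperbolic k (s : 'M[F]_1) (u : 'M_(1, k)) (T : 'M_k) :
  (block_mx (0 : 'M_1) (row_mx 1%:M 0) (row_mx 1%:M 0)^T (block_mx s u u^T T) \in unitmx) =
  (T \in unitmx).
Proof.
rewrite tr_row_mx tr_scalar_mx trmx0; apply/idP/idP => hu; last first.
  have : block_mx (0 : 'M_1) (row_mx 1%:M (0 : 'M_(1, k))) (col_mx 1%:M 0)
      (block_mx s u u^T T) *m
    block_mx (u *m invmx T *m u^T - s) (row_mx 1%:M (- (u *m invmx T)))
      (col_mx 1%:M (- (invmx T *m u^T))) (block_mx 0 0 0 (invmx T)) = 1%:M.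
    rewrite mulmx_block mul_row_block mul_row_col mulmx_block mul_block_col.
    rewrite mul_col_row mul_col_mx mul_mx_row.
    rewrite !(mul0mx, mulmx0, mul1mx, mulmx1, add0r, addr0).
    rewrite add_row_mx add_col_mx add_block_mx !mulmxN !mulmxA mulmxV //.
    rewrite mul1mx !addr0 !add0r addNr subrr addrA subrK subrr row_mx0 col_mx0.
    by rewrite -!scalar_mx_block.
  by case/mulmx1_unit.
have := mulmxV hu; move: (invmx _) => N; rewrite -[N]submxK.
move: (ulsubmx N) (ursubmx N) (dlsubmx N) (drsubmx N) => a b c d.
rewrite -[b]hsubmxK -[c]vsubmxK -[d]submxK; set d1 := ursubmx d; set d2 := drsubmx d.
rewrite mulmx_block mul_row_block mulmx_block mul_col_row.
rewrite !(mul0mx, mul1mx, addr0, add0r) add_block_mx !add0r.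
rewrite [RHS]scalar_mx_block => /eq_block_mx[_ + _].
rewrite -[X in _ = X -> _]row_mx0 => /eq_row_mx[_ ->].
rewrite scalar_mx_block => /eq_block_mx[_ _ _].
by rewrite mulmx0 add0r => /mulmx1_unit[].
Qed.

(* Splitting off the first row: a nonzero corner leaves its Schur complement, and
   a zero corner with nonzero row splits off a hyperbolic plane. *)
Lemma sym_countSS k : sym_count k.+2 =
  (q - 1) * q ^+ k.+1 * sym_count k.+1 + (q ^+ k.+1 - 1) * q ^+ k.+1 * sym_count k.
Proof.
have -> : sym_count k.+2 = \sum_(A : 'M[F]_1 | A^T == A) \sum_(v : 'M_(1, 1 + k))
   \sum_(D : 'M_(1 + k) | (D^T == D) && (block_mx A v v^T D \in unitmx)) 1.
  exact: (@sum_sym_block 1 (1 + k) (mem unitmx) (fun=> 1)).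
rewrite (bigD1 0) /= ?trmx0 // addrC; congr (_ + _).
  transitivity (\sum_(A : 'M[F]_1 | A != 0) \sum_(v : 'rV[F]_(1 + k)) sym_count k.+1).
    apply: eq_big => A.
      suff -> : A^T = A by rewrite eqxx.
      by apply/matrixP => i j; rewrite mxE !ord1.
    case/andP=> /eqP hA A0; apply: eq_bigr => v _.
    have uA : A \in unitmx.
      by rewrite unitmxE [A]mx11_scalar det_scalar1 unitfE; apply: contraNneq A0 => h;
        rewrite [A]mx11_scalar h raddf0.
    have sX : (v^T *m invmx A *m v)^T = v^T *m invmx A *m v.
      by rewrite !trmx_mul trmxK trmx_inv hA mulmxA.
    (* The correction term of the Schur complement is symmetric, so shifting D by it preserves
       symmetry and leaves the invertibility of D alone. *)
    rewrite (reindex_inj (addIr (v^T *m invmx A *m v))) /=; apply: eq_bigl => D.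
    by rewrite unitmx_schur // addrK raddfD /= sX (inj_eq (addIr _)).
  have -> : \sum_(A : 'M[F]_1 | A != 0) \sum_(v : 'rV[F]_(1 + k)) sym_count k.+1 =
    (\sum_(A : 'M[F]_1 | A != 0) 1) * (q ^+ k.+1 * sym_count k.+1).
    by rewrite mulr_suml; apply: eq_bigr => A _;
      rewrite sumr_const card_mx mul1r mul1n -natrX mulr_natl.
  by rewrite sum1_mx_neq0 mulrA.
(* With zero corner and v = 0 the matrix has a zero first row and is singular. *)
rewrite (bigD1 0) //= big_pred0 ?add0r => [|D]; last first.
  apply/negP => /andP[_]; rewrite trmx0 unitmxE det_ublock [0]mx11_scalar.
  by rewrite det_scalar1 mxE mul0r unitr0.
rewrite -mulrA -[X in _ ^+ X - 1]mul1n -sum1_mx_neq0 mulr_suml; apply: eq_bigr => v v0.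
rewrite mul1r; have [P uP ->] := row_mulmx_unit v0.
set e := row_mx _ _.
have uPT : P^T \in unitmx by rewrite unitmx_tr.
(* Congruence by diag(1, P) brings v = e P back to e, so each nonzero v contributes as much as e. *)
rewrite (reindex (fun D => P^T *m D *m P)) /=; last first.
  exists (fun D => invmx P^T *m D *m invmx P) => D _.
    by rewrite !mulmxA mulVmx // mul1mx mulmxK.
  by rewrite !mulmxA mulmxV // mul1mx mulmxKV.
have bE D : block_mx 0 (e *m P) (e *m P)^T (P^T *m D *m P) =
    block_mx (1%:M : 'M_1) 0 0 P^T *m block_mx 0 e e^T D *m block_mx 1%:M 0 0 P.
  rewrite !mulmx_block !(mul0mx, mulmx0, mul1mx, mulmx1, add0r, addr0).
  by rewrite trmx_mul.
transitivity (\sum_(D : 'M[F]_(1 + k) | (D^T == D) &&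
    (block_mx (0 : 'M_1) e e^T D \in unitmx)) (1 : algC)).
  apply: eq_bigl => D; rewrite bE !unitmx_mul !block_diag_mx_unit uP uPT !unitmx1 /= andbT.
  rewrite !trmx_mul trmxK mulmxA; congr (_ && _).
  by rewrite (can_eq (mulmxK _)) // (can_eq (mulKmx _)).
transitivity (\sum_(s : 'M[F]_1 | s^T == s) \sum_(u : 'M_(1, k)) \sum_(D : 'M_k |
    (D^T == D) && (block_mx (0 : 'M_1) e e^T (block_mx s u u^T D) \in unitmx)) (1 : algC)).
  exact: (@sum_sym_block 1 k (fun D => block_mx 0 e e^T D \in unitmx) (fun=> 1)).
transitivity (\sum_(s : 'M[F]_1) \sum_(u : 'M[F]_(1, k)) sym_count k).
  apply: eq_big => [s|s _].
    by apply/eqP/matrixP => i j; rewrite mxE !ord1.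
  apply: eq_bigr => u _; apply: eq_bigl => D.
  by rewrite unitmx_hyperbolic.
by rewrite !sumr_const !card_mx -mulrnA !mul1n -expnD addn1 -natrX mulr_natl.
Qed.

(** The recursion reaches back two sizes, so both parities are carried through one induction. *)
Lemma sym_countE k :
  sym_count (k.*2) = q ^+ (k * k.+1) * oddprod q k /\
  sym_count (k.*2.+1) = q ^+ (k * k.+1) * oddprod q k.+1.
Proof.
elim: k => [|k [IH0 IH1]].
  rewrite mul0n expr0 !mul1r /oddprod big_geq // big_nat1; split.
    by rewrite /sym_count sum_mx0 // trmx0 eqxx unitmxE det_mx00 unitr1.
  transitivity (q ^+ (1 * 1) - 1) => //; rewrite -sum1_mx_neq0; apply: eq_bigl => A.
  rewrite unitmxE [in \det A](mx11_scalar A) det_scalar1 unitfE.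
  have -> : A^T == A by apply/eqP/matrixP => i j; rewrite mxE !ord1.
  congr (~~ _); apply/eqP/eqP => [h|->]; last by rewrite mxE.
  by rewrite [A]mx11_scalar h raddf0.
have PS j : oddprod q j.+1 = oddprod q j * (q ^+ j.*2.+1 - 1).
  by rewrite /oddprod big_nat_recr //= mulnC muln2 doubleS subn1.
have e0 : sym_count k.+1.*2 = q ^+ (k.+1 * k.+2) * oddprod q k.+1.
  rewrite doubleS sym_countSS IH0 IH1 PS.
  have -> : (k.+1 * k.+2 = k.*2.+1 + 1 + k * k.+1)%N.
    by rewrite -muln2; ring.
  rewrite !exprD expr1; ring.
split=> //; rewrite doubleS sym_countSS -doubleS e0 IH1 [oddprod q k.+2]PS.
have -> : (k.+1 * k.+2 = k.*2.+2 + k * k.+1)%N by rewrite -muln2; ring.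
rewrite doubleS !exprD -[q ^+ k.*2.+3]mulr1 [q ^+ k.*2.+3]exprS; ring.
Qed.
End OddCharacteristic.
End Counting.

(** * Quadratic Gauss sums *)

Section QuadraticGaussSum.
Variables (F : finFieldType) (eps : F) (psi : F -> algC).
Hypothesis two_neq0 : 2%:R != 0 :> F.
Hypothesis eps_nonsquare : forall x : F, x * x != eps.
Hypothesis psi0 : psi 0 = 1.
Hypothesis psiD : forall x y : F, psi (x + y) = psi x * psi y.
Hypothesis psi_nt : exists x : F, psi x != 1.
Local Notation q := (#|F|%:R : algC).

Lemma mx11_eq0 (A : 'M[F]_1) : (A == 0) = (A 0 0 == 0).
Proof.
apply/eqP/eqP => [->|h]; first by rewrite mxE.
by rewrite [A]mx11_scalar h raddf0.
Qed.

Lemma unitmx11 (A : 'M[F]_1) : (A \in unitmx) = (A != 0).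
Proof. by rewrite unitmxE [A in \det A]mx11_scalar det_scalar1 unitfE mx11_eq0. Qed.

(** Polarisation: if v S v^T always vanished, evaluating at sums of basis vectors would give 2 S i j
    = 0, hence S = 0. *)
Lemma exists_anisotropic k (S : 'M[F]_(1 + k)) : S^T = S -> S \in unitmx ->
  exists v : 'rV_(1 + k), v *m S *m v^T != 0.
Proof.
move=> hS uS; apply/existsP; apply: contraT => /existsPn h.
have {}h (v : 'rV_(1 + k)) : v *m S *m v^T = 0 by apply/eqP/negPn; exact: h.
have S0 : S = 0.
  apply/matrixP => i j; rewrite mxE.
  pose x : 'rV[F]_(1 + k) := delta_mx 0 i; pose y : 'rV[F]_(1 + k) := delta_mx 0 j.
  have xy : x *m S *m y^T = (S i j)%:M.
    by rewrite /x /y trmx_delta -rowE -colE; apply/matrixP => a b; rewrite !mxE !ord1 eqxx.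
  have yx : y *m S *m x^T = (S i j)%:M.
    by rewrite -[RHS]tr_scalar_mx -xy !trmx_mul trmxK hS mulmxA.
  have := h (x + y).
  rewrite raddfD /= !mulmxDl !mulmxDr !h xy yx addr0 add0r -raddfD /= -mulr2n.
  move/matrixP/(_ 0 0)/eqP; rewrite !mxE eqxx mulr1n -mulr_natl mulf_eq0.
  by rewrite (negPf two_neq0) => /eqP.
have := mulmxV uS; rewrite S0 mul0mx => /matrixP/(_ 0 0)/eqP.
by rewrite !mxE eqxx eq_sym oner_eq0.
Qed.

(** The anisotropic vector becomes the first row of P, so its value is the corner of P S P^T. *)
Lemma congruent_corner k (S : 'M[F]_(1 + k)) : S^T = S -> S \in unitmx ->
  exists2 P : 'M[F]_(1 + k), P \in unitmx & ulsubmx (P *m S *m P^T) != 0.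
Proof.
move=> hS uS; have [v hv] := exists_anisotropic hS uS.
have v0 : v != 0 by apply: contraNneq hv => ->; rewrite !mul0mx.
have [P uP vE] := row_mulmx_unit v0; exists P => //.
suff -> : ulsubmx (P *m S *m P^T) = v *m S *m v^T by [].
set e := row_mx _ _ in vE.
have -> : v *m S *m v^T = e *m (P *m S *m P^T) *m e^T.
  by rewrite vE trmx_mul !mulmxA.
rewrite -[in RHS](submxK (P *m S *m P^T)) /e tr_row_mx tr_scalar_mx trmx0.
by rewrite mul_row_block mul_row_col !mul0mx !mul1mx !addr0 mulmx1 mulmx0 addr0.
Qed.

Local Notation form h := (h^T *m delta eps *m h).

Lemma trace_col_form (x : 'M[F]_(2, 1)) (a : 'M[F]_1) :
  \tr (a *m form x) = a 0 0 * (x 0 0 ^+ 2 - eps * x 1 0 ^+ 2).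
Proof.
rewrite delta_mx2 [a]mx11_scalar mul_scalar_mx mxtraceZ mxE eqxx mulr1n; congr (_ * _).
rewrite /mxtrace big_ord1 !mxE !big_ord_recl big_ord0 !mxE !big_ord_recl !big_ord0 !mxE /=.
have -> : lift ord0 ord0 = 1 :> 'I_2 by apply/val_inj.
ring.
Qed.

Lemma sum_psi_col (c : F) (a : 'M[F]_1) : c != 0 -> a != 0 ->
  \sum_(x : 'M[F]_(2, 1)) psi (c * \tr (a *m form x)) = - q.
Proof.
move=> c0 a0; under eq_bigr do rewrite trace_col_form mulrA.
have ca0 : c * a 0 0 != 0 by rewrite mulf_neq0 // -mx11_eq0.
rewrite -(sum_psi_norm_form two_neq0 eps_nonsquare psi0 psiD psi_nt ca0) pair_big /=.
rewrite (reindex (fun x : 'M[F]_(2, 1) => (x 0 0, x 1 0))) //=.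
exists (fun p => \matrix_(i, _) if i == 0 then p.1 else p.2) => [x|[u v]] _ /=.
  apply/matrixP => i j; rewrite !mxE !ord1.
  by case: i => [[|[|//]] hi] /=; congr (x _ _); apply/val_inj.
by rewrite !mxE.
Qed.

(** Diagonalising S by congruence splits the sum over h into sums over single columns. Each is a
    Gauss sum of a scaled norm form, equal to -q for every nonzero diagonal entry. *)
Lemma gauss_sum m (S : 'M[F]_m) (c : F) : c != 0 -> S^T = S -> S \in unitmx ->
  \sum_(h : 'M[F]_(2, m)) psi (c * \tr (S *m form h)) = (- q) ^+ m.
Proof.
move=> c0; elim: m S => [|k IH] S hS uS.
  rewrite (big_pred1 0) => [|h]; first by rewrite /mxtrace big_ord0 mulr0 psi0.
  by rewrite /= (thinmx0 h) eqxx.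
have [P uP hc] := @congruent_corner k S hS uS.
pose M : 'M_(1 + k) := P *m S *m P^T.
have hM : M^T = M by rewrite /M !trmx_mul trmxK hS mulmxA.
have uM : M \in unitmx by rewrite !unitmx_mul uP uS unitmx_tr uP.
transitivity (\sum_(h : 'M[F]_(2, 1 + k)) psi (c * \tr (M *m form h))).
  (* By cyclicity of the trace, substituting h P for h replaces S by P S P^T. *)
  rewrite (reindex (fun h : 'M_(2, 1 + k) => h *m P)) /=; last first.
    by exists (mulmxr (invmx P)) => h _ /=; rewrite ?mulmxK ?mulmxKV.
  apply: eq_bigr => h _; congr (psi (_ * _)).
  by rewrite /M -!mulmxA [RHS]mxtrace_mulC trmx_mul !mulmxA.
set N := M in hM uM *; set a := ulsubmx N in hc *.
have Nbl : N = block_mx a (ursubmx N) (ursubmx N)^T (drsubmx N).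
  by rewrite -[LHS]submxK -[in dlsubmx N]hM -trmx_ursub.
have ua : a \in unitmx by rewrite unitmx11.
have ha : a^T = a by rewrite /a trmx_ulsub hM.
set b := ursubmx N in Nbl; set d := drsubmx N in Nbl.
have hd : d^T = d by rewrite /d trmx_drsub hM.
pose S' := d - b^T *m invmx a *m b.
have hS' : S'^T = S' by rewrite raddfB /= hd !trmx_mul trmxK trmx_inv ha mulmxA.
have uS' : S' \in unitmx by rewrite -unitmx_schur // -Nbl.
(* Completing the square: L splits N into its corner a and the Schur complement S'. *)
pose L := block_mx (1%:M : 'M_1) (invmx a *m b) 0 (1%:M : 'M_k).
have NE : N = L^T *m block_mx a 0 0 S' *m L.
  rewrite /L tr_block_mx !tr_scalar_mx trmx0 trmx_mul trmx_inv ha !mulmx_block.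
  rewrite !(mul0mx, mulmx0, mul1mx, mulmx1, add0r, addr0) mulmxKV // mulKVmx //.
  by rewrite [LHS]Nbl /S' mulmxA addrC subrK.
have uL : L \in unitmx by rewrite unitmxE det_ublock !det1 mulr1 unitr1.
transitivity (\sum_(h : 'M[F]_(2, 1 + k)) psi (c * \tr (block_mx a 0 0 S' *m form h))).
  rewrite [RHS](reindex (fun h : 'M_(2, 1 + k) => h *m L^T)) /=; last first.
    by exists (mulmxr (invmx L^T)) => h _ /=; rewrite ?mulmxK ?mulmxKV // unitmx_tr.
  apply: eq_bigr => h _; congr (psi (_ * _)).
  by rewrite NE -!mulmxA [LHS]mxtrace_mulC trmx_mul trmxK !mulmxA.
rewrite sum_row_mx exprS -(IH S') // -(sum_psi_col c0 hc) mulr_suml.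
apply: eq_bigr => x _; rewrite mulr_sumr; apply: eq_bigr => h _.
rewrite -psiD -mulrDr; congr (psi (_ * _)).
have -> : form (row_mx x h) = block_mx (form x) (x^T *m delta eps *m h)
    (h^T *m delta eps *m x) (form h).
  by rewrite tr_row_mx mul_col_mx mul_col_row.
by rewrite mulmx_block !mul0mx !addr0 !add0r mxtrace_block.
Qed.
End QuadraticGaussSum.

(** * Sums over double cosets *)

Lemma invmx_mul (R : comUnitRingType) n (A B : 'M[R]_n) :
  A \in unitmx -> B \in unitmx -> invmx (A *m B) = invmx B *m invmx A.
Proof.
move=> uA uB; rewrite -[RHS]mul1mx -(mulVmx (_ : A *m B \in unitmx)).
  by rewrite -!mulmxA (mulKVmx uB) mulmxV // mulmx1.
by rewrite unitmx_mul uA uB.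
Qed.

Section DoubleCoset.
Variables (F : finFieldType) (N : nat) (Q : {set 'M[F]_N}) (g s : 'M[F]_N).
Variable f : 'M[F]_N -> algC.
Hypothesis Q1 : 1%:M \in Q.
Hypothesis QM : forall x y, x \in Q -> y \in Q -> x *m y \in Q.
Hypothesis QU : forall x, x \in Q -> x \in unitmx.
Hypothesis gU : g \in unitmx.
Hypothesis sU : s \in unitmx.
Hypothesis Qg : forall x, x \in Q -> exists2 x', x' \in Q & x *m g = g *m x'.
Hypothesis fC : forall x y, f (x *m y) = f (y *m x).

(** Right multiplication by k is an injection of the finite set Q into itself, hence onto. Closure
    under inverses follows from closure under products. *)
Lemma group_mulr_stable k x : k \in Q -> (x *m k \in Q) = (x \in Q).
Proof.
move=> kQ; have uk := QU kQ.
have inj : injective (mulmx^~ k) by move=> a b; apply: (can_inj (mulmxK uk)).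
have sub : [set x *m k | x in Q] \subset Q.
  by apply/subsetP => y /imsetP[z zQ ->]; apply: QM.
have /eqP imQ : [set x *m k | x in Q] == Q by rewrite eqEcard sub card_imset /=.
apply/idP/idP => h; last exact: QM.
by move: h; rewrite -{1}imQ => /imsetP[z zQ /inj ->].
Qed.

Lemma group_mem_inv x : x \in Q -> invmx x \in Q.
Proof. by move=> xQ; rewrite -(group_mulr_stable _ xQ) mulVmx ?QU. Qed.

Lemma group_mull_stable k x : k \in Q -> (k *m x \in Q) = (x \in Q).
Proof.
move=> kQ; apply/idP/idP => h; last exact: QM.
by rewrite -(mulKmx (QU kQ) x); apply: QM => //; apply: group_mem_inv.
Qed.

(* Every w in g Q s Q has as many factorizations g x s y as the first set has
   elements, and the cyclicity of f with Q g = g Q removes y from f (g x s y). *)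
Lemma double_coset_sum :
  #|[set k in Q | invmx s *m k *m s \in Q]|%:R *
    (\sum_(w in [set g *m x *m s *m y | x in Q, y in Q]) f w) =
  #|Q|%:R * \sum_(x in Q) f (g *m x *m s).
Proof.
set D := [set _ | _ in _, _ in _]; set H := [set k in Q | _].
pose w_of (p : 'M[F]_N * 'M[F]_N) := g *m p.1 *m s *m p.2.
transitivity (\sum_(p | (p.1 \in Q) && (p.2 \in Q)) f (w_of p)).
  rewrite (partition_big w_of (mem D)) /=; last first.
    by move=> [x y] /andP[xQ yQ]; apply: imset2_f.
  rewrite mulr_sumr; apply: eq_bigr => w /imset2P[x0 y0 x0Q y0Q wE].
  rewrite (eq_bigr (fun=> f w)) => [|p /andP[_ /eqP->]//].
  rewrite sumr_const -[RHS]mulr_natl; congr (_%:R * _).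
  (* All factorizations of w arise from the given one by moving some k across s; the second factor
     stays in Q exactly when k lies in the intersection H. *)
  pose k_of (k : 'M[F]_N) := (x0 *m k, invmx s *m invmx k *m s *m y0).
  have ux0 := QU x0Q; have uy0 := QU y0Q.
  have k_inj : {in H &, injective k_of}.
    by move=> k1 k2 _ _ [] /(can_inj (mulKmx ux0)).
  rewrite -(card_in_imset k_inj); apply: eq_card => -[x y]; apply/imsetP/idP.
    case=> k; rewrite inE => /andP[kQ kH] [-> ->]; have uk := QU kQ.
    rewrite unfold_in /= QM //= /w_of /= wE; apply/andP; split.
      rewrite QM //; have := group_mem_inv kH.
      by rewrite !invmx_mul ?unitmx_mul ?unitmx_inv ?sU ?uk // invmxK mulmxA.
    by rewrite !mulmxA mulmxK // mulmxK.
  rewrite unfold_in /= => /andP[/andP[xQ yQ] /eqP h]; have ux := QU xQ.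
  have yE : y = invmx s *m (invmx x *m x0) *m s *m y0.
    move: h; rewrite /w_of wE /= => h.
    have : invmx s *m (invmx x *m (invmx g *m (g *m x *m s *m y))) = y.
      by rewrite -!mulmxA mulKmx // mulKmx // mulKmx.
    by rewrite h -!mulmxA mulKmx // => <-.
  exists (invmx x0 *m x).
    rewrite inE (group_mull_stable _ (group_mem_inv x0Q)) xQ /=.
    have /group_mem_inv : invmx s *m (invmx x *m x0) *m s \in Q.
      by rewrite -(group_mulr_stable _ y0Q) -yE.
    rewrite !invmx_mul ?unitmx_mul ?unitmx_inv ?sU ?ux ?ux0 //.
    by rewrite !invmxK !mulmxA.
  by rewrite /k_of mulKVmx // invmx_mul ?unitmx_inv // invmxK -yE.
rewrite -(pair_big (mem Q) (mem Q) (fun x y => f (w_of (x, y)))) /= exchange_big /=.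
rewrite mulr_natl -sumr_const; apply: eq_bigr => y yQ.
(* Cyclicity brings y in front of g; then y g = g z, and z is absorbed into x. *)
have [z zQ zE] := Qg yQ; rewrite [RHS](reindex (mulmx z)) /=.
  apply: eq_big => x; first by rewrite group_mull_stable.
  by move=> _; rewrite /w_of /= fC !mulmxA zE.
by exists (mulmx (invmx z)) => x _; rewrite ?mulKmx ?mulKVmx // QU.
Qed.
End DoubleCoset.

(** * The parabolic subgroup Q *)

Lemma congruence_mul (R : comPzRingType) n (K x y : 'M[R]_n) :
  x^T *m K *m x = K -> y^T *m K *m y = K -> (x *m y)^T *m K *m (x *m y) = K.
Proof. by move=> hx hy; rewrite trmx_mul mulmxA -2!(mulmxA y^T) hx hy. Qed.

Section Parabolic.
Variables (F : finFieldType) (eps : F).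
Hypothesis eps_nonsquare : forall x : F, x * x != eps.

(** Only the zero pattern of Q is imposed. The relations between the blocks are recovered from the
    preservation of J. *)
Definition parabolic_mx m (A X D : 'M[F]_m) (Y : 'M_(m, 2)) (Z : 'M_(2, m)) (i : 'M_2) :=
  block_mx (block_mx A X 0 D) (col_mx Y 0) (row_mx 0 Z) i.

Local Notation J m := (Jmx eps m.+1 : 'M[F]_(m + m + 2)).
Local Notation Q m := (Qset eps m.+1 : {set 'M[F]_(m + m + 2)}).
Local Notation delta := (delta eps).

Lemma QeltE m (A B : 'M[F]_m) h i :
  Qelt eps A B h i = parabolic_mx A (A *m B) (invmx A)^T (- (A *m h^T *m delta)) (i *m h) i.
Proof.
rewrite /Qelt mulmx_block !(mul0mx, mulmx0, mul1mx, mulmx1, addr0, add0r).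
rewrite mulmx_block !(mul0mx, mulmx0, mul1mx, mulmx1, addr0, add0r).
rewrite mul_block_col !(mul0mx, mulmx0, mul1mx, mulmx1, addr0, add0r) mul_mx_row mulmx0.
by rewrite mulmxN mulmxA.
Qed.

Lemma parabolic_mx_inj m (A A' X X' D D' : 'M[F]_m) Y Y' Z Z' i i' :
  parabolic_mx A X D Y Z i = parabolic_mx A' X' D' Y' Z' i' ->
  [/\ A = A', X = X', D = D', Y = Y' & Z = Z' /\ i = i'].
Proof.
by case/eq_block_mx => /eq_block_mx[-> -> _ ->] /eq_col_mx[-> _] /eq_row_mx[_ ->] ->.
Qed.

Lemma delta_sym : delta^T = delta.
Proof. by rewrite delta_mx2 tr_mx2. Qed.

Lemma delta_unit : delta \in unitmx.
Proof.
rewrite delta_mx2 unitmxE det_mx2 unitfE mul1r mul0r subr0 oppr_eq0.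
by have := eps_nonsquare 0; rewrite mul0r eq_sym.
Qed.

Lemma JmxE m : J m = block_mx (block_mx 0 1%:M 1%:M 0) 0 0 delta.
Proof. by []. Qed.

Lemma parabolic_mx_form m (A X D : 'M[F]_m) Y Z i :
  (parabolic_mx A X D Y Z i)^T *m J m *m parabolic_mx A X D Y Z i =
  block_mx (block_mx 0 (A^T *m D) (D^T *m A) (X^T *m D + D^T *m X + Z^T *m delta *m Z))
    (col_mx 0 (D^T *m Y + Z^T *m delta *m i))
    (row_mx 0 (Y^T *m D + i^T *m delta *m Z)) (i^T *m delta *m i).
Proof.
have -> : (parabolic_mx A X D Y Z i)^T = block_mx (block_mx A^T 0 X^T D^T) (col_mx 0 Z^T)
    (row_mx Y^T 0) i^T.
  by rewrite tr_block_mx (tr_block_mx A) tr_col_mx tr_row_mx !trmx0.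
rewrite JmxE -mulmxA.
have -> : block_mx (block_mx 0 1%:M 1%:M 0) 0 0 delta *m parabolic_mx A X D Y Z i =
  block_mx (block_mx 0 D A X) (col_mx 0 Y) (row_mx 0 (delta *m Z)) (delta *m i).
  rewrite mulmx_block !(mul0mx, mulmx0, mul1mx, mulmx1, addr0, add0r).
  rewrite mulmx_block !(mul0mx, mulmx0, mul1mx, mulmx1, addr0, add0r).
  by rewrite mul_block_col !(mul0mx, mulmx0, mul1mx, mulmx1, addr0, add0r) mul_mx_row ?mulmx0.
rewrite mulmx_block (mulmx_block A^T) mul_block_col mul_row_block mul_row_col.
rewrite mul_col_row mul_col_mx mul_mx_row add_block_mx add_col_mx add_row_mx.
by rewrite !(mul0mx, mulmx0, mul1mx, mulmx1, addr0, add0r) !mulmxA.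
Qed.

(** In this description, isometries of J with the right zero pattern and det i = 1, stability under
    products and conjugation is read off from zero patterns, with no need to track A, B and h. *)
Lemma QsetP m (w : 'M[F]_(m + m + 2)) :
  reflect (exists A X D Y Z i,
    [/\ w = parabolic_mx A X D Y Z i, w^T *m J m *m w = J m & \det i = 1]) (w \in Q m).
Proof.
rewrite inE; apply: (iffP existsP).
  case=> A /existsP[B /existsP[h /existsP[i /and4P[uA hi /eqP hB /eqP ->]]]].
  move: hi; rewrite inE => /andP[/eqP hi /eqP di].
  exists A, (A *m B), (invmx A)^T, (- (A *m h^T *m delta)), (i *m h), i.
  split => //; first exact: QeltE.
  rewrite QeltE parabolic_mx_form hi JmxE -trmx_mul mulVmx // trmx1 !trmxK mulVmx //.
  have hd : (i *m h)^T *m delta *m i = h^T *m delta.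
    by rewrite trmx_mul -!mulmxA [i^T *m _]mulmxA hi.
  rewrite [i^T *m _ *m (i *m h)]mulmxA hi.
  have -> : (A *m B)^T *m (invmx A)^T + invmx A *m (A *m B) + (i *m h)^T *m delta *m (i *m h) = 0.
    by rewrite -hB -trmx_mul !mulKmx // mulmxA hd.
  have -> : invmx A *m - (A *m h^T *m delta) + (i *m h)^T *m delta *m i = 0.
    by rewrite hd mulmxN -mulmxA mulKmx // addNr.
  have -> : (- (A *m h^T *m delta))^T *m (invmx A)^T + delta *m h = 0.
    rewrite -trmx_mul mulmxN -mulmxA mulKmx // raddfN /= trmx_mul trmxK delta_sym.
    by rewrite addNr.
  by rewrite col_mx0 row_mx0.
move=> [A [X [D [Y [Z [i [-> hJ di]]]]]]].
move: hJ; rewrite parabolic_mx_form JmxE.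
(* The blocks of the isometry equation give A^T D = 1, the condition on B = A^-1 X with h = i^-1 Z,
   the value of Y, and i^T delta i = delta. *)
case/eq_block_mx => /eq_block_mx[_ AD _ hX]; rewrite -[X in _ = X -> _]col_mx0.
case/eq_col_mx => _ hY _ hi.
have [uAT uD] := mulmx1_unit AD; have uA : A \in unitmx by rewrite -unitmx_tr.
have ui : i \in unitmx by rewrite unitmxE di unitr1.
have DE : D = (invmx A)^T.
  by rewrite trmx_inv -[D](mulKmx uAT) AD mulmx1.
have DT : D^T = invmx A by rewrite DE trmxK.
exists A; apply/existsP; exists (invmx A *m X); apply/existsP; exists (invmx i *m Z).
apply/existsP; exists i.
have hd : (invmx i *m Z)^T *m delta = Z^T *m delta *m i.
  rewrite trmx_mul -[delta in LHS]hi !mulmxA -[Z^T *m _ *m i^T]mulmxA -trmx_mul.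
  by rewrite mulmxV // trmx1 mulmx1.
apply/and4P; split => //.
- by rewrite inE hi di !eqxx.
- by rewrite hd -[_ *m i *m _]mulmxA mulKVmx // -DT trmx_mul trmxK hX.
apply/eqP; rewrite QeltE mulKVmx // mulKVmx // -DE; congr (parabolic_mx _ _ _ _ _ _).
apply/eqP; rewrite -mulmxA hd -addr_eq0; apply/eqP.
by rewrite -[Y](mulKVmx uA) -mulmxDr -DT hY mulmx0.
Qed.

Lemma Jmx_unit m : J m \in unitmx.
Proof.
rewrite JmxE block_diag_mx_unit delta_unit andbT.
have : block_mx 0 1%:M 1%:M 0 *m block_mx 0 1%:M 1%:M 0 = 1%:M :> 'M[F]_(m + m).
  by rewrite mulmx_block !(mul0mx, mulmx0, mul1mx, mulmx1, addr0, add0r) -scalar_mx_block.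
by case/mulmx1_unit.
Qed.

Lemma Qset1 m : 1%:M \in Q m.
Proof.
apply/QsetP; exists 1%:M, 0, 1%:M, 0, 0, 1%:M; rewrite det1; split=> //.
  by rewrite /parabolic_mx col_mx0 row_mx0 -!scalar_mx_block.
by rewrite trmx1 mul1mx mulmx1.
Qed.

Lemma QsetM m (x y : 'M[F]_(m + m + 2)) : x \in Q m -> y \in Q m -> x *m y \in Q m.
Proof.
move=> /QsetP[A [X [D [Y [Z [i [xE xJ di]]]]]]] /QsetP[A' [X' [D' [Y' [Z' [i' [yE yJ di']]]]]]].
apply/QsetP; exists (A *m A'), (A *m X' + X *m D' + Y *m Z'), (D *m D'),
  (A *m Y' + Y *m i'), (Z *m D' + i *m Z'), (i *m i').
rewrite det_mulmx di di' mulr1; split=> //; last first.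
  exact: congruence_mul.
rewrite xE yE /parabolic_mx mulmx_block (mulmx_block A) mul_block_col mul_row_block mul_row_col.
rewrite mul_col_row mul_col_mx mul_mx_row add_block_mx add_col_mx add_row_mx.
by rewrite !(mul0mx, mulmx0, mul1mx, mulmx1, addr0, add0r).
Qed.

Lemma Qset_unit m (x : 'M[F]_(m + m + 2)) : x \in Q m -> x \in unitmx.
Proof.
case/QsetP=> A [X [D [Y [Z [i [_ xJ _]]]]]]; have := Jmx_unit m.
by rewrite -[J m]xJ !unitmx_mul => /andP[].
Qed.

(* Equals 1 for d = 1 and rho for d = diag(1,-1). *)
Definition tailmx m (d : 'M[F]_2) : 'M[F]_(m + m + 2) := block_mx 1%:M 0 0 d.

Lemma tailmx_form m d : d^T *m delta *m d = delta ->
  (tailmx m d)^T *m J m *m tailmx m d = J m.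
Proof.
move=> hd; rewrite tr_block_mx trmx1 !trmx0 JmxE !mulmx_block.
by rewrite !(mul0mx, mulmx0, mul1mx, mulmx1, addr0, add0r) hd.
Qed.

Lemma tailmx_involution m d : d *m d = 1%:M -> tailmx m d *m tailmx m d = 1%:M.
Proof.
move=> dd; rewrite mulmx_block !(mul0mx, mulmx0, mul1mx, mulmx1, addr0, add0r) dd.
by rewrite -scalar_mx_block.
Qed.

Lemma Qset_tailmx m d (x : 'M[F]_(m + m + 2)) :
    d^T *m delta *m d = delta -> d *m d = 1%:M -> x \in Q m ->
  exists2 x', x' \in Q m & x *m tailmx m d = tailmx m d *m x'.
Proof.
move=> hd dd /QsetP[A [X [D [Y [Z [i [xE xJ di]]]]]]].
exists (tailmx m d *m x *m tailmx m d); last first.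
  by rewrite !mulmxA tailmx_involution // mul1mx.
apply/QsetP; exists A, X, D, (Y *m d), (d *m Z), (d *m i *m d); split.
- rewrite xE mulmx_block !(mul0mx, mulmx0, mul1mx, mulmx1, addr0, add0r) mulmx_block.
  by rewrite !(mul0mx, mulmx0, mul1mx, mulmx1, addr0, add0r) mul_col_mx mul_mx_row mul0mx mulmx0.
- by do 2?[apply: congruence_mul]; rewrite ?tailmx_form.
(* The square of det d is 1, so conjugation by d preserves det i = 1. *)
have := congr1 determinant dd; rewrite det1 det_mulmx => dd1.
by rewrite !det_mulmx di mulr1.
Qed.

End Parabolic.

(** * The elements sigma_r in block form and conjugation by them *)

Section Sigma.
Variables (F : finFieldType) (eps : F) (r t : nat).

Local Notation m := (r + t)%N.
Local Notation J := (Jmx eps m.+1 : 'M[F]_(m + m + 2)).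
Local Notation Q := (Qset eps m.+1 : {set 'M[F]_(m + m + 2)}).
Local Notation delta := (delta eps).

Definition headproj : 'M[F]_m := block_mx 1%:M 0 0 0.
Definition tailproj : 'M[F]_m := block_mx 0 0 0 1%:M.
Definition sigma_block : 'M[F]_(m + m + 2) :=
  block_mx (block_mx tailproj headproj headproj tailproj) 0 0 1%:M.

Lemma headproj_mx (i j : 'I_m) :
  headproj i j = ((i < r)%N && (i == j :> nat))%:R.
Proof.
rewrite !mxE; case: splitP => i' hi; rewrite !mxE; case: splitP => j' hj; rewrite !mxE hi hj.
- by [].
- by case: eqP => // h; have := ltn_ord i'; lia.
- by [].
by [].
Qed.

Lemma tailproj_mx (i j : 'I_m) :
  tailproj i j = ((r <= i)%N && (i == j :> nat))%:R.
Proof.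
rewrite !mxE; case: splitP => i' hi; rewrite !mxE; case: splitP => j' hj; rewrite !mxE hi hj.
- by rewrite leqNgt ltn_ord.
- by rewrite leqNgt ltn_ord.
- have -> : (r + i' == j')%N = false by have := ltn_ord j'; lia.
  by rewrite andbF.
by rewrite leq_addr eqn_add2l.
Qed.

Lemma sigmaE : sigma F m.+1 r = sigma_block.
Proof.
apply/matrixP => i j; rewrite mxE /sigma_block /= !mxE.
case: splitP => i' hi; rewrite !mxE; case: splitP => j' hj; rewrite ?mxE.
- case: splitP => i1 hi1; rewrite !mxE; case: splitP => j1 hj1;
    rewrite ?headproj_mx ?tailproj_mx hi hj hi1 hj1;
    (case: ifP => h; [rewrite (_ : _ && _ = true) //|rewrite (_ : _ && _ = false) //]);
    have := ltn_ord i1; have := ltn_ord j1; move: h; lia.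
- by rewrite hi hj; case: ifP => //; have := ltn_ord i'; lia.
- by rewrite hi hj; case: ifP => //; have := ltn_ord j'; lia.
rewrite hi hj; have := ltn_ord i'; have := ltn_ord j'.
have -> : (i' == j') = (i' == j' :> nat) by [].
by case: ifP => h; have [e|ne] := eqVneq (i' : nat) j'; rewrite //; exfalso; move: h; lia.
Qed.

Lemma headproj_idem : headproj *m headproj = headproj.
Proof. by rewrite mulmx_block !(mul0mx, mulmx0, mul1mx, mulmx1, addr0, add0r). Qed.

Lemma tailproj_idem : tailproj *m tailproj = tailproj.
Proof. by rewrite mulmx_block !(mul0mx, mulmx0, mul1mx, mulmx1, addr0, add0r). Qed.

Lemma head_tailproj : headproj *m tailproj = 0.
Proof. by rewrite mulmx_block !(mul0mx, mulmx0, mul1mx, mulmx1, addr0, add0r) block_mx0. Qed.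

Lemma tail_headproj : tailproj *m headproj = 0.
Proof. by rewrite mulmx_block !(mul0mx, mulmx0, mul1mx, mulmx1, addr0, add0r) block_mx0. Qed.

Lemma tail_add_headproj : tailproj + headproj = 1%:M.
Proof. by rewrite add_block_mx !(addr0, add0r) -scalar_mx_block. Qed.

Lemma sigma_involution : sigma_block *m sigma_block = 1%:M.
Proof.
rewrite mulmx_block !(mul0mx, mulmx0, mul1mx, addr0, add0r).
rewrite mulmx_block headproj_idem tailproj_idem head_tailproj tail_headproj.
by rewrite [headproj + _]addrC tail_add_headproj addr0 -!scalar_mx_block.
Qed.

Lemma sigma_unit : sigma_block \in unitmx.
Proof. by case/mulmx1_unit: sigma_involution. Qed.

Lemma invmx_sigma : invmx sigma_block = sigma_block.
Proof. by rewrite -[LHS]mulmx1 -sigma_involution mulKmx // sigma_unit. Qed.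

Lemma sigma_form : sigma_block^T *m J *m sigma_block = J.
Proof.
have -> : sigma_block^T = sigma_block.
  by rewrite tr_block_mx (tr_block_mx tailproj) !tr_block_mx !trmx0 !trmx1.
have e1 : block_mx tailproj headproj headproj tailproj *m block_mx 0 1%:M 1%:M 0 =
    block_mx headproj tailproj tailproj headproj.
  by rewrite mulmx_block !(mul0mx, mulmx0, mul1mx, mulmx1, addr0, add0r).
have e2 : block_mx headproj tailproj tailproj headproj *m
    block_mx tailproj headproj headproj tailproj = block_mx 0 1%:M 1%:M 0.
  rewrite mulmx_block headproj_idem tailproj_idem head_tailproj tail_headproj !addr0.
  by rewrite tail_add_headproj [headproj + _]addrC tail_add_headproj.
rewrite JmxE mulmx_block !(mul0mx, mulmx0, mul1mx, mulmx1, addr0, add0r) e1.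
by rewrite mulmx_block !(mul0mx, mulmx0, mul1mx, mulmx1, addr0, add0r) e2.
Qed.

Lemma sigma_conj_parabolic A X D Y Z i :
  sigma_block *m parabolic_mx A X D Y Z i *m sigma_block = block_mx
   (block_mx
      (tailproj *m A *m tailproj + tailproj *m X *m headproj + headproj *m D *m headproj)
      (tailproj *m A *m headproj + tailproj *m X *m tailproj + headproj *m D *m tailproj)
      (headproj *m A *m tailproj + headproj *m X *m headproj + tailproj *m D *m headproj)
      (headproj *m A *m headproj + headproj *m X *m tailproj + tailproj *m D *m tailproj))
   (col_mx (tailproj *m Y) (headproj *m Y)) (row_mx (Z *m headproj) (Z *m tailproj)) i.
Proof.
have e1 : sigma_block *m parabolic_mx A X D Y Z i = block_mx
    (block_mx (tailproj *m A) (tailproj *m X + headproj *m D)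
              (headproj *m A) (headproj *m X + tailproj *m D))
    (col_mx (tailproj *m Y) (headproj *m Y)) (row_mx 0 Z) i.
  rewrite mulmx_block !(mul0mx, mulmx0, mul1mx, mulmx1, addr0, add0r).
  by rewrite mulmx_block mul_block_col !(mul0mx, mulmx0, mul1mx, mulmx1, addr0, add0r).
rewrite e1 mulmx_block !(mul0mx, mulmx0, mul1mx, mulmx1, addr0, add0r).
rewrite mulmx_block mul_row_block !(mul0mx, mulmx0, mul1mx, mulmx1, addr0, add0r).
by rewrite !mulmxDl !addrA; congr (block_mx (block_mx _ _ _ _) _ _ _); rewrite addrAC.
Qed.

(** Conjugation by sigma_r preserves J and fixes the block i, so membership in Q only asks that the
    blocks outside the parabolic zero pattern vanish. *)
Lemma sigma_conj_mem (w : 'M[F]_(m + m + 2)) (A X D : 'M[F]_m) Y Z i :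
    w \in Q -> w = parabolic_mx A X D Y Z i ->
  (sigma_block *m w *m sigma_block \in Q) =
  [&& headproj *m A *m tailproj + headproj *m X *m headproj + tailproj *m D *m headproj == 0,
      headproj *m Y == 0 & Z *m headproj == 0].
Proof.
move=> wQ wE; apply/QsetP/and3P.
  case=> A' [X' [D' [Y' [Z' [i' [+ _ _]]]]]]; rewrite wE sigma_conj_parabolic.
  by case/eq_block_mx => /eq_block_mx[_ _ -> _] /eq_col_mx[_ ->] /eq_row_mx[-> _] _.
case=> /eqP h1 /eqP h2 /eqP h3.
have [A' [X' [D' [Y' [Z' [i' [wE' wJ di]]]]]]] := elimT (QsetP _ _) wQ.
have [_ _ _ _ [_ ii]] := parabolic_mx_inj (etrans (esym wE) wE').
do 6!eexists; split; first by rewrite wE sigma_conj_parabolic h1 h2 h3; reflexivity.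
  by do 2?[apply: congruence_mul]; rewrite ?sigma_form.
by rewrite ii.
Qed.
End Sigma.

(** * Trace sums over Q *)

Lemma unitmx_lblock (R : comUnitRingType) r t (a : 'M[R]_r) (c : 'M_(t, r)) (d : 'M_t) :
  (block_mx a 0 c d \in unitmx) = (a \in unitmx) && (d \in unitmx).
Proof. by rewrite unitmxE det_lblock unitrM -!unitmxE. Qed.

Lemma invmx_lblock (R : comUnitRingType) r t (a : 'M[R]_r) (c : 'M_(t, r)) (d : 'M_t) :
  block_mx a 0 c d \in unitmx ->
  ursubmx (invmx (block_mx a 0 c d)) = 0 /\ drsubmx (invmx (block_mx a 0 c d)) = invmx d.
Proof.
move=> u; move: (u); rewrite unitmx_lblock => /andP[ua ud].
have := mulmxV u; move: (invmx (block_mx _ _ _ _)) => N; rewrite -[N in _ *m N]submxK.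
rewrite mulmx_block !mul0mx !addr0 scalar_mx_block => /eq_block_mx[_ h12 _ h22].
have n12 : ursubmx N = 0 by rewrite -[LHS](mulKmx ua) h12 mulmx0.
by split=> //; rewrite -[LHS](mulKmx ud); move: h22; rewrite n12 mulmx0 add0r => ->; rewrite mulmx1.
Qed.

Section ParabolicSums.
Variables (F : finFieldType) (eps : F) (r t : nat).

Local Notation m := (r + t)%N.
Local Notation Q := (Qset eps m.+1 : {set 'M[F]_(m + m + 2)}).
Local Notation delta := (delta eps).
Local Notation form h := (h^T *m delta *m h).
Local Notation q := (#|F|%:R : algC).

Lemma headproj_tailproj_corner (M : 'M[F]_m) :
  headproj F r t *m M *m tailproj F r t = block_mx 0 (ursubmx M) 0 0.
Proof.
rewrite -{1}[M]submxK mulmx_block !(mul0mx, mulmx0, mul1mx, mulmx1, addr0, add0r).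
by rewrite mulmx_block !(mul0mx, mulmx0, mul1mx, mulmx1, addr0, add0r).
Qed.

Lemma headproj_headproj_corner (M : 'M[F]_m) :
  headproj F r t *m M *m headproj F r t = block_mx (ulsubmx M) 0 0 0.
Proof.
rewrite -{1}[M]submxK mulmx_block !(mul0mx, mulmx0, mul1mx, mulmx1, addr0, add0r).
by rewrite mulmx_block !(mul0mx, mulmx0, mul1mx, mulmx1, addr0, add0r).
Qed.

Lemma tailproj_headproj_corner (M : 'M[F]_m) :
  tailproj F r t *m M *m headproj F r t = block_mx 0 0 (dlsubmx M) 0.
Proof.
rewrite -{1}[M]submxK mulmx_block !(mul0mx, mulmx0, mul1mx, mulmx1, addr0, add0r).
by rewrite mulmx_block !(mul0mx, mulmx0, mul1mx, mulmx1, addr0, add0r).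
Qed.

Lemma Qelt_mem (A B : 'M[F]_m) h i : A \in unitmx -> i \in SOm2 eps ->
  B^T + B + form h == 0 -> Qelt eps A B h i \in Q.
Proof.
move=> uA hi hB; rewrite inE; apply/existsP; exists A; apply/existsP; exists B.
by apply/existsP; exists h; apply/existsP; exists i; rewrite uA hi hB eqxx.
Qed.

Lemma SOm2_unit i : i \in SOm2 eps -> i \in unitmx.
Proof. by rewrite inE => /andP[_ /eqP di]; rewrite unitmxE di unitr1. Qed.

(** The parameters (A, h, B, i) are unique, as A and i are invertible blocks of the product. The sum
    over h precedes that over B because h fixes the coset in which B varies. *)
Lemma sum_Qset (f : 'M[F]_(m + m + 2) -> algC) :
  \sum_(x in Q) f x =
  \sum_(A | A \in unitmx) \sum_h \sum_(B | B^T + B + form h == 0)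
    \sum_(i in SOm2 eps) f (Qelt eps A B h i).
Proof.
pose qelt (p : 'M[F]_m * ('M[F]_(2, m) * ('M[F]_m * 'M[F]_2))) :=
  Qelt eps p.1 p.2.2.1 p.2.1 p.2.2.2.
pose S := [set p : 'M[F]_m * ('M[F]_(2, m) * ('M[F]_m * 'M[F]_2)) |
  (p.1 \in unitmx) && ((p.2.2.1^T + p.2.2.1 + form p.2.1 == 0) && (p.2.2.2 \in SOm2 eps))].
have QS : Q = [set qelt p | p in S].
  apply/setP => x; apply/idP/imsetP.
    rewrite inE => /existsP[A /existsP[B /existsP[h /existsP[i /and4P[uA hi hB /eqP ->]]]]].
    by exists (A, (h, (B, i))) => //; rewrite inE /= uA hi hB.
  by case=> -[A [h [B i]]]; rewrite inE /= => /and3P[uA hB hi] ->; apply: Qelt_mem.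
have qelt_inj : {in S &, injective qelt}.
  move=> [A [h [B i]]] [A' [h' [B' i']]]; rewrite !inE /= => /and3P[uA _ hi] _.
  rewrite /qelt /= !QeltE => /parabolic_mx_inj[AA BB _ _ [hh ii]].
  have ui : i \in unitmx by apply: SOm2_unit; rewrite inE.
  rewrite -AA -ii in BB hh *.
  have -> : h = h' by rewrite -[h](mulKmx ui) hh mulKmx.
  by have -> : B = B' by rewrite -[B](mulKmx uA) BB mulKmx.
rewrite QS big_imset //=.
under [RHS]eq_bigr => A _ do under eq_bigr => h _ do rewrite (pair_big_dep
  (fun B => B^T + B + form h == 0) (fun B i => i \in SOm2 eps)
  (fun B i => f (Qelt eps A B h i))) /=.
under [RHS]eq_bigr => A _ do rewrite (pair_big_dep xpredT
  (fun h p => (p.1^T + p.1 + form h == 0) && (p.2 \in SOm2 eps))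
  (fun h p => f (Qelt eps A p.1 h p.2))) /=.
rewrite (pair_big_dep (fun A => A \in unitmx)
  (fun A p => (p.2.1^T + p.2.1 + form p.1 == 0) && (p.2.2 \in SOm2 eps))
  (fun A p => f (Qelt eps A p.2.1 p.1 p.2.2))) /=.
by apply: eq_bigl => p; rewrite inE.
Qed.

Lemma trace_Qelt_sigma d A B h i :
  \tr (tailmx m d *m Qelt eps A B h i *m sigma_block F r t) =
  \tr (d *m i) + (\tr (drsubmx A) + \tr (drsubmx (invmx A)) + \tr (ulsubmx (A *m B))).
Proof.
have e1 : tailmx m d *m Qelt eps A B h i = parabolic_mx A (A *m B) (invmx A)^T
    (- (A *m h^T *m delta)) (d *m (i *m h)) (d *m i).
  rewrite QeltE mulmx_block !(mul0mx, mulmx0, mul1mx, mulmx1, addr0, add0r).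
  by rewrite mul_mx_row mulmx0.
rewrite e1 mulmx_block !(mul0mx, mulmx0, mul1mx, mulmx1, addr0, add0r).
rewrite mxtrace_block mulmx_block mxtrace_block !(mul0mx, add0r) mxtraceD addrC; congr (_ + _).
have trT (M : 'M[F]_m) : \tr (M *m tailproj F r t) = \tr (drsubmx M).
  rewrite -{1}[M]submxK mulmx_block !(mul0mx, mulmx0, mul1mx, mulmx1, addr0, add0r).
  by rewrite mxtrace_block mxtrace0 add0r.
have trH (M : 'M[F]_m) : \tr (M *m headproj F r t) = \tr (ulsubmx M).
  rewrite -{1}[M]submxK mulmx_block !(mul0mx, mulmx0, mul1mx, mulmx1, addr0, add0r).
  by rewrite mxtrace_block mxtrace0 addr0.
by rewrite !trT trH -trmx_drsub mxtrace_tr addrAC.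
Qed.

(* Describes the intersection of Q with its conjugate by sigma_r. *)
Lemma sigma_conj_Qelt (A B : 'M[F]_m) h i : A \in unitmx -> i \in SOm2 eps ->
  B^T + B + form h == 0 ->
  (sigma_block F r t *m Qelt eps A B h i *m sigma_block F r t \in Q) =
  [&& ursubmx A == 0, ulsubmx B == 0 & lsubmx h == 0].
Proof.
move=> uA hi hB; rewrite (sigma_conj_mem (Qelt_mem uA hi hB) (QeltE _ _ _ _ _)).
rewrite headproj_tailproj_corner headproj_headproj_corner tailproj_headproj_corner.
rewrite !add_block_mx !(addr0, add0r) block_mx_eq0.
have hE (h' : 'M_(2, m)) : headproj F r t *m h'^T = col_mx (lsubmx h')^T 0.
  by rewrite -[in LHS](hsubmxK h') tr_row_mx mul_block_col !(mul0mx, mul1mx, addr0).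
have hE' (h' : 'M_(2, m)) : h' *m headproj F r t = row_mx (lsubmx h') 0.
  by rewrite -[in LHS](hsubmxK h') mul_row_block !(mulmx0, mulmx1, addr0).
rewrite hE' -[X in row_mx _ _ == X]row_mx0.
apply/and3P/and3P.
  case=> /and4P[/eqP h11 /eqP h12 _ _] _ /eqP/eq_row_mx[hh _].
  have ui := SOm2_unit hi; split; first by rewrite h12.
    (* Once A12 = 0 the block A11 is invertible, and (A B)11 = A11 B11 = 0 forces B11 = 0. *)
    have := uA; rewrite -[A]submxK h12 unitmx_lblock => /andP[ua _].
    move: h11; rewrite -[A in A *m _]submxK -[B in _ *m B]submxK h12 mulmx_block block_mxKul.
    by rewrite mul0mx addr0 => h11; rewrite -[X in X == _](mulKmx ua) h11 mulmx0.
  by rewrite -[lsubmx h](mulKmx ui) mulmx_lsub hh mulmx0.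
case=> /eqP h12 /eqP h11 /eqP hh.
have := uA; rewrite -[A in A \in _]submxK h12 => uA'; have [n12 _] := invmx_lblock uA'.
split.
- rewrite !eqxx andbT /=; apply/andP; split; last first.
    by rewrite -trmx_ursub -[A]submxK h12 n12 trmx0 eqxx.
  rewrite -[A in A *m _]submxK -[B in _ *m B]submxK h12 h11 mulmx_block block_mxKul.
  by rewrite mul0mx mulmx0 addr0.
- rewrite mulmxN mulmxA mulmxA.
  have -> : headproj F r t *m A *m h^T = 0.
    rewrite -[A]submxK h12 -[h]hsubmxK hh tr_row_mx trmx0 mulmx_block mul_block_col.
    by rewrite !(mul0mx, mulmx0, addr0, add0r) col_mx0.
  by rewrite mul0mx oppr0.
by apply/eqP; congr row_mx; rewrite -mulmx_lsub hh mulmx0.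
Qed.
End ParabolicSums.

(** * Character sums over Q, the order of Q and that of its intersection with a conjugate *)

Section TraceSums.
Variables (F : finFieldType) (eps : F) (psi : F -> algC).
Hypothesis two_neq0 : 2%:R != 0 :> F.
Hypothesis eps_nonsquare : forall x : F, x * x != eps.
Hypothesis psi0 : psi 0 = 1.
Hypothesis psiD : forall x y : F, psi (x + y) = psi x * psi y.
Hypothesis psi_nt : exists x : F, psi x != 1.
Local Notation q := (#|F|%:R : algC).
Local Notation delta := (delta eps).
Local Notation form h := (h^T *m delta *m h).
Local Notation alt_count := (alt_count F).
Local Notation sym_count := (sym_count F).
Local Notation unit_count := (unit_count F).

Definition kloosterman_GL t : algC :=
  \sum_(D : 'M[F]_t | D \in unitmx) psi (\tr D + \tr (invmx D)).

Lemma form_sym m (h : 'M[F]_(2, m)) : (form h)^T = form h.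
Proof. by rewrite !trmx_mul trmxK delta_sym mulmxA. Qed.

Lemma form_row r t (h1 : 'M[F]_(2, r)) (h2 : 'M_(2, t)) :
  form (row_mx h1 h2) =
  block_mx (form h1) (h1^T *m delta *m h2) (h1^T *m delta *m h2)^T (form h2).
Proof.
by rewrite !trmx_mul trmxK delta_sym mulmxA tr_row_mx mul_col_mx mul_col_row.
Qed.

(* For symmetric a the trace is constant on the coset; otherwise the character is
   nontrivial on the alternating translations. *)
Lemma sum_psi_alternating m (a C : 'M[F]_m) : C^T = C ->
  \sum_(B : 'M[F]_m | B^T + B + C == 0) psi (\tr (a *m B)) =
  if a^T == a then psi (- 2%:R^-1 * \tr (a *m C)) * alt_count m else 0.
Proof.
move=> hC; case: eqP => [ha|/eqP ha].
  rewrite -(sum_alternating_coset two_neq0 hC) mulr_sumr; apply: eq_bigr => B.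
  rewrite addr_eq0 mulr1 => /eqP hB; congr psi.
  have e : \tr (a *m B^T) = \tr (a *m B).
    by rewrite -mxtrace_tr trmx_mul trmxK ha mxtrace_mulC.
  (* Since a is symmetric, tr (a C) = -2 tr (a B); this is the origin of the factor -1/2. *)
  have -> : C = - (B^T + B) by rewrite hB opprK.
  rewrite mulmxN raddfN /= mulmxDr mxtraceD e; by field.
have /matrix0Pn[i [j]] : a - a^T != 0 by rewrite subr_eq0 eq_sym.
rewrite !mxE => hij; have [y0 hy0] := psi_nt.
(* The scale is chosen so that tr (a K) = [y0] for the alternating matrix K below. *)
pose c := (a i j - a j i)^-1 * y0.
pose K : 'M[F]_m := c *: (delta_mx j i - delta_mx i j).
have KT : K^T = - K by rewrite linearZ /= raddfB /= !trmx_delta -scalerN opprB.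
apply: (@sum_translate_eq0 _ (fun B : 'M[F]_m => B^T + B + C == 0)
  (fun B => psi (\tr (a *m B))) K (psi y0)) => // B.
  by rewrite raddfD /= KT addrACA addNr add0r.
rewrite mulmxDr mxtraceD psiD; congr (psi _ * _).
rewrite -scalemxAr mxtraceZ mulmxBr raddfB /= !mxtrace_mul_delta.
by rewrite /c mulrAC mulVf // mul1r.
Qed.

Section Blocks.
Variables r t : nat.
Local Notation m := (r + t)%N.
Local Notation Q := (Qset eps m.+1 : {set 'M[F]_(m + m + 2)}).

(** The corner of the product is a B11 + b B21. The free block B21 forces b = 0, the sum over B11
    forces a to be symmetric, and B22 is merely counted. *)
Lemma sum_psi_ulsub_block (a : 'M[F]_r) (b : 'M_(r, t)) (c : 'M_(t, r)) (d : 'M_t) h1 h2 :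
  \sum_(B : 'M[F]_m | B^T + B + form (row_mx h1 h2) == 0)
    psi (\tr (ulsubmx (block_mx a b c d *m B))) =
  if (b == 0) && (a^T == a)
  then q ^+ (t * r) * alt_count r * alt_count t * psi (- 2%:R^-1 * \tr (a *m form h1)) else 0.
Proof.
rewrite form_row sum_alternating_block.
transitivity (\sum_(B11 : 'M[F]_r | B11^T + B11 + form h1 == 0) psi (\tr (a *m B11)) *
   (\sum_(B21 : 'M[F]_(t, r)) psi (\tr (b *m B21)) * alt_count t)).
  apply: eq_bigr => B11 _; rewrite mulr_sumr; apply: eq_bigr => B21 _.
  rewrite -(sum_alternating_coset two_neq0 (form_sym h2)) !mulr_sumr.
  apply: eq_bigr => B22 _.
  by rewrite mulmx_block block_mxKul mxtraceD psiD mulr1.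
rewrite -mulr_suml -mulr_suml (sum_char_mx psi0 psiD psi_nt).
rewrite (sum_psi_alternating _ (form_sym h1)).
case: eqP => _; case: eqP => _ /=; rewrite ?mul0r ?mulr0 //; ring.
Qed.

(** The factors come, in order, from the Gauss sum over the first r columns of h, its other t
    columns, the free block B21, and the cosets of B11 and B22. *)
Let C : algC := (- q) ^+ r * q ^+ (2 * t) * q ^+ (t * r) * alt_count r * alt_count t.

Lemma sum_psi_ulsub (a : 'M[F]_r) (b : 'M_(r, t)) (c : 'M_(t, r)) (d : 'M_t) :
  block_mx a b c d \in unitmx ->
  \sum_(h : 'M[F]_(2, m)) \sum_(B : 'M[F]_m | B^T + B + form h == 0)
    psi (\tr (ulsubmx (block_mx a b c d *m B))) =
  if (b == 0) && (a^T == a) then C else 0.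
Proof.
move=> u; rewrite sum_row_mx.
under eq_bigr => h1 _ do under eq_bigr => h2 _ do rewrite sum_psi_ulsub_block.
case: ifP => [/andP[/eqP b0 /eqP ha]|_]; last by rewrite big1 // => h1 _; rewrite big1.
have ua : a \in unitmx by move: u; rewrite b0 unitmx_lblock => /andP[].
have c0 : - 2%:R^-1 != 0 :> F by rewrite oppr_eq0 invr_eq0.
rewrite /C -(gauss_sum two_neq0 eps_nonsquare psi0 psiD psi_nt c0 ha ua) -!mulrA [RHS]mulr_suml.
apply: eq_bigr => h1 _; rewrite sum_const_mx; ring.
Qed.

(** With A12 = 0 the lower right block of A^-1 is the inverse of A22, so A22 yields the Kloosterman
    sum over GL(t,q). A21 is free and A11 runs over the invertible symmetric matrices. *)
Lemma sum_Qset_trace (d : 'M[F]_2) :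
  \sum_(x in Q) psi (\tr (tailmx m d *m x *m sigma_block F r t)) =
  C * sym_count r * q ^+ (t * r) * kloosterman_GL t * \sum_(i in SOm2 eps) psi (\tr (d *m i)).
Proof.
rewrite sum_Qset.
under eq_bigr => A _ do under eq_bigr => h _ do under eq_bigr => B _ do
  under eq_bigr => i _ do rewrite trace_Qelt_sigma psiD.
under eq_bigr => A _ do under eq_bigr => h _ do under eq_bigr => B _ do
  rewrite -mulr_suml mulrC psiD.
under eq_bigr => A _ do under eq_bigr => h _ do
  rewrite -mulr_suml -mulr_sumr.
under eq_bigr => A _ do rewrite -mulr_suml -mulr_sumr.
rewrite -mulr_suml; congr (_ * _).
rewrite sum_block_mx.
transitivity (\sum_(a : 'M[F]_r | (a^T == a) && (a \in unitmx))
   \sum_(c : 'M[F]_(t, r)) C * kloosterman_GL t); last first.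
  rewrite -2!mulrA [sym_count r * _]mulrC mulrA /sym_count [RHS]mulr_sumr; apply: eq_bigr => a _.
  by rewrite sum_const_mx; ring.
rewrite [RHS]big_mkcond; apply: eq_bigr => a _ /=.
rewrite (bigD1 0) //= [X in _ + X]big1 ?addr0 => [|b b0]; last first.
  by rewrite big1 // => c _; rewrite big1 // => d' u; rewrite sum_psi_ulsub // (negPf b0) mulr0.
case: ifP => ha; last first.
  rewrite big1 // => c _; rewrite big1 // => d' u; rewrite sum_psi_ulsub // eqxx /=.
  by move: u; rewrite unitmx_lblock => /andP[ua _]; rewrite ua andbT in ha; rewrite ha mulr0.
case/andP: ha => ha ua; apply: eq_bigr => c _.
rewrite /kloosterman_GL mulr_sumr; apply: eq_big => d'; first by rewrite unitmx_lblock ua.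
move=> u; rewrite sum_psi_ulsub // eqxx ha /= mulrC; congr (_ * psi (_ + _)).
  by rewrite block_mxKdr.
by have [_ ->] := invmx_lblock u.
Qed.

Lemma card_Qset : (#|Q|%:R : algC) = unit_count m * q ^+ (2 * m) * alt_count m * (q + 1).
Proof.
rewrite -sumr_const sum_Qset.
under eq_bigr => A _ do under eq_bigr => h _ do under eq_bigr => B _ do
  rewrite (card_SOm2 two_neq0 eps_nonsquare) -[_ + _]mul1r.
under eq_bigr => A _ do under eq_bigr => h _ do
  rewrite -mulr_suml (sum_alternating_coset two_neq0 (form_sym h)).
under eq_bigr => A _ do rewrite sum_const_mx -[X in X * _]mul1r -mulrA.
by rewrite -mulr_suml -!mulrA.
Qed.

(** The conditions A12 = 0, B11 = 0 and h1 = 0 leave A11, A22, A21, then h2, B21, B22 and i; the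
    factors appear in that order. *)
Lemma card_Qset_conj :
  (#|[set k in Q | sigma_block F r t *m k *m sigma_block F r t \in Q]|%:R : algC) =
  unit_count r * unit_count t * q ^+ (t * r) * q ^+ (2 * t) * q ^+ (t * r) * alt_count t * (q + 1).
Proof.
rewrite -sumr_const.
transitivity (\sum_(x in Q)
    if sigma_block F r t *m x *m sigma_block F r t \in Q then 1 else 0 : algC).
  by rewrite -big_mkcondr; apply: eq_bigl => x; rewrite inE.
rewrite sum_Qset.
pose G (A : 'M[F]_m) (h : 'M[F]_(2, m)) (B : 'M[F]_m) : algC :=
  if [&& ursubmx A == 0, ulsubmx B == 0 & lsubmx h == 0] then 1 else 0.
transitivity ((\sum_(A | A \in unitmx) \sum_h \sum_(B | B^T + B + form h == 0) G A h B)
   * (q + 1)).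
  rewrite mulr_suml; apply: eq_bigr => A uA.
  rewrite mulr_suml; apply: eq_bigr => h _.
  rewrite mulr_suml; apply: eq_bigr => B hB.
  rewrite -(card_SOm2 two_neq0 eps_nonsquare) mulr_sumr; apply: eq_bigr => i hi.
  by rewrite sigma_conj_Qelt // mulr1.
congr (_ * _).
have SB A h1 h2 : \sum_(B | B^T + B + form (row_mx h1 h2) == 0) G A (row_mx h1 h2) B =
    if (ursubmx A == 0) && (h1 == 0) then q ^+ (t * r) * alt_count t else 0.
  rewrite form_row sum_alternating_block /G.
  under eq_bigr => B11 _ do under eq_bigr => B21 _ do under eq_bigr => B22 _ do
    rewrite block_mxKul row_mxKl.
  case: (ursubmx A == 0) => /=; last by rewrite big1 // => *; rewrite big1 // => *; rewrite big1.
  case: eqP => [h0|h0]; last first.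
    by rewrite big1 // => *; rewrite big1 // => *; rewrite big1 // => *; rewrite andbF.
  rewrite (bigD1 0) ?h0 /=; last by rewrite mulmx0 trmx0 !addr0.
  rewrite [X in _ + X]big1 ?addr0 => [|B /andP[_ /negPf B0]]; last first.
    by rewrite big1 // => *; rewrite big1 // => *; rewrite B0.
  rewrite eqxx /=; under eq_bigr do rewrite (sum_alternating_coset two_neq0 (form_sym _)).
  by rewrite sum_const_mx.
have Sh A : \sum_h \sum_(B | B^T + B + form h == 0) G A h B =
    if ursubmx A == 0 then q ^+ (2 * t) * (q ^+ (t * r) * alt_count t) else 0.
  rewrite sum_row_mx; under eq_bigr => h1 _ do under eq_bigr => h2 _ do rewrite SB.
  case: ifP => _ /=; last by rewrite big1 // => *; rewrite big1.
  rewrite (bigD1 0) //= [X in _ + X]big1 ?addr0 => [|h1 /negPf h0]; last first.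
    by rewrite big1 // => *; rewrite h0.
  by rewrite eqxx sum_const_mx.
under eq_bigr do rewrite Sh.
rewrite sum_block_mx.
transitivity (\sum_(a : 'M[F]_r | a \in unitmx) \sum_(c : 'M[F]_(t, r))
   (q ^+ (2 * t) * (q ^+ (t * r) * alt_count t)) * unit_count t); last first.
  under eq_bigr => a _ do rewrite sum_const_mx -[q ^+ _ * _]mul1r.
  rewrite -mulr_suml -/(unit_count r); ring.
rewrite [RHS]big_mkcond; apply: eq_bigr => a _ /=.
rewrite (bigD1 0) //= [X in _ + X]big1 ?addr0 => [|b b0]; last first.
  by rewrite big1 // => c _; rewrite big1 // => d' u; rewrite block_mxKur (negPf b0).
case: ifP => ua; last first.
  by rewrite big1 // => c _; rewrite big_pred0 // => d'; rewrite unitmx_lblock ua.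
apply: eq_bigr => c _; rewrite /unit_count [RHS]mulr_sumr; apply: eq_big => d'.
  by rewrite unitmx_lblock ua.
by rewrite block_mxKur eqxx mulr1.
Qed.
End Blocks.
End TraceSums.

(** * Assembly *)

(** Translation by 1 permutes F, so comparing the sums of all elements gives |F| = 0 in F. With |F|
    odd, 2 = 0 would then mean 1 = 0. *)
Lemma odd_card_two_neq0 (F : finFieldType) : odd #|F| -> 2%:R != 0 :> F.
Proof.
move=> oddF; apply/eqP => two0.
have card0 : (#|F|%:R : F) = 0.
  apply: (@addrI _ (\sum_(x : F) x)); rewrite addr0 -sumr_const -big_split /=.
  by rewrite [RHS](reindex_inj (addIr 1)).
have := oner_eq0 F; rewrite -card0 -[#|F|]odd_double_half oddF -muln2 natrD natrM two0.
by rewrite mulr0 addr0 eqxx.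
Qed.

Lemma bin2_even k : 'C(k.*2, 2) = (k * (k.*2).-1)%N.
Proof. by rewrite bin2 -doubleMl doubleK. Qed.

Lemma bin2_odd k : 'C(k.*2.+1, 2) = (k.*2.+1 * k)%N.
Proof. by rewrite bin2 /= -doubleMr doubleK. Qed.

Section Assembly.
Variables (F : finFieldType) (eps : F) (psi : F -> algC).
Hypothesis two_neq0 : 2%:R != 0 :> F.
Hypothesis eps_nonsquare : forall x : F, x * x != eps.
Hypothesis psi0 : psi 0 = 1.
Hypothesis psiD : forall x y : F, psi (x + y) = psi x * psi y.
Hypothesis psi_nt : exists x : F, psi x != 1.
Local Notation q := (#|F|%:R : algC).
Local Notation K := (Kl psi 1).

Lemma q_gt1 : 1 < q.
Proof. by rewrite ltr1n finNzRing_gt1. Qed.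

Lemma q_neq0 : q != 0.
Proof. by rewrite gt_eqF // (lt_trans ltr01 q_gt1). Qed.

Lemma qX_sub1_neq0 k : q ^+ k.+1 - 1 != 0.
Proof. by rewrite subr_eq0 gt_eqF // exprn_egt1 // q_gt1. Qed.

Lemma q_add1_neq0 : q + 1 != 0.
Proof. by rewrite gt_eqF // addr_gt0 ?ltr01 // (lt_trans ltr01 q_gt1). Qed.

(* |Q| / |Q /\ sigma Q sigma^-1| times the part of the sum over Q which does not depend
   on the SO^-(2,q) and GL(t,q) factors. *)
Definition coset_coef r t : algC :=
  unit_count F (r + t) / (unit_count F r * unit_count F t) *
  (q ^+ (2 * (r + t) + 'C(r + t, 2) + 'C(r, 2)) * (- q) ^+ r * sym_count F r).

Lemma trsum_double_coset r t (d : 'M[F]_2) :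
    d^T *m delta eps *m d = delta eps -> d *m d = 1%:M ->
  \sum_(w in [set tailmx (r + t) d *m x *m sigma_block F r t *m y
             | x in Qset eps (r + t).+1, y in Qset eps (r + t).+1]) psi (\tr w) =
  coset_coef r t * kloosterman_GL psi t * \sum_(i in SOm2 eps) psi (\tr (d *m i)).
Proof.
move=> hd dd.
have := @double_coset_sum F (r + t + (r + t) + 2) (Qset eps (r + t).+1) (tailmx (r + t) d)
  (sigma_block F r t) (fun w => psi (\tr w)) (Qset1 eps (r + t))
  (@QsetM F eps (r + t)) (@Qset_unit F eps eps_nonsquare (r + t)).
have gU : tailmx (r + t) d \in unitmx by case: (mulmx1_unit (tailmx_involution (r + t) dd)).
move/(_ gU (sigma_unit F r t)).
move/(_ (fun x => @Qset_tailmx F eps (r + t) d x hd dd)).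
move/(_ (fun x y => congr1 psi (mxtrace_mulC x y))).
rewrite invmx_sigma (card_Qset_conj two_neq0 eps_nonsquare).
rewrite (card_Qset two_neq0 eps_nonsquare).
rewrite (sum_Qset_trace two_neq0 eps_nonsquare psi0 psiD psi_nt).
rewrite /coset_coef; set S := \sum_(w in _) _ => h.
(* This is the order of the intersection; cancelling it divides by the number of factorizations of
   each element. *)
have nz : unit_count F r * unit_count F t * q ^+ (t * r) * q ^+ (2 * t) *
    q ^+ (t * r) * alt_count F t * (q + 1) != 0.
  by rewrite !mulf_neq0 ?unit_count_neq0 ?expf_neq0 ?q_neq0 ?q_add1_neq0 //
    alt_countE // expf_neq0 ?q_neq0.
apply: (mulfI nz); rewrite h !exprD -!(alt_countE two_neq0); field.
by rewrite !unit_count_neq0.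
Qed.

Lemma kloosterman_GL0 : kloosterman_GL psi 0 = 1.
Proof.
rewrite /kloosterman_GL sum_mx0; first by rewrite /mxtrace !big_ord0 addr0 psi0.
by rewrite unitmxE det_mx00 unitr1.
Qed.

Lemma kloosterman_GL1 : kloosterman_GL psi 1 = K.
Proof.
rewrite /kloosterman_GL /Kl (reindex (fun x : F => x%:M)) /=; last first.
  exists (fun A : 'M_1 => A 0 0) => A _; last by rewrite [RHS]mx11_scalar.
  by rewrite mxE eqxx mulr1n.
apply: eq_big => x; first by rewrite unitmxE det_scalar1 unitfE.
by rewrite invmx_scalar !mxtrace_scalar !mulr1n mul1r.
Qed.

Lemma kloosterman_GL2 : kloosterman_GL psi 2 = KGL psi 1.
Proof. by apply: eq_bigr => w _; rewrite mul1r. Qed.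

Lemma unit_count1 : unit_count F 1 = q - 1.
Proof. by rewrite unit_countS unit_count0 expr0 mul1r mulr1 expr1. Qed.

Lemma unit_count2 : unit_count F 2 = q * (q ^+ 2 - 1) * (q - 1).
Proof. by rewrite unit_countS unit_count1 expr1. Qed.

Lemma coset_coef0 r : coset_coef r 0 =
  (-1) ^+ r * (q ^+ (2 * r + 'C(r, 2) + 'C(r, 2) + r) * sym_count F r).
Proof.
rewrite /coset_coef unit_count0 mulr1 addn0 divff ?unit_count_neq0 //.
rewrite [(- q) ^+ r]exprNn !exprD; ring.
Qed.

(** In the exponent the first [r] is the q^(rt) that accompanies the q-binomial, and the last [r]
    comes from (-q)^r. *)
Lemma coset_coef1 r : coset_coef r 1 =
  (-1) ^+ r * (q ^+ (r + 2 * r.+1 + 'C(r.+1, 2) + 'C(r, 2) + r) * qbin q r.+1 1 * sym_count F r).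
Proof.
rewrite /coset_coef unit_count1 addn1 unit_countS [(- q) ^+ r]exprNn.
rewrite /qbin big_ord1 !subn0 expr1 !exprD; field.
by rewrite -[q]expr1 qX_sub1_neq0 unit_count_neq0.
Qed.

Lemma coset_coef2 r : coset_coef r 2 =
  (-1) ^+ r * (q ^+ (2 * r + 2 * r.+2 + 'C(r.+2, 2) + 'C(r, 2) + r) * qbin q r.+2 2 *
   sym_count F r).
Proof.
rewrite /coset_coef unit_count2 addn2 !unit_countS [(- q) ^+ r]exprNn.
rewrite /qbin !big_ord_recr big_ord0 /= !subn0 !subn1 /= expr1 mul1r.
rewrite !mul2n -!addnn !exprD !exprS; field.
have q1 : q - 1 != 0 := qX_sub1_neq0 0.
by rewrite q_neq0 unit_count_neq0 q1 (qX_sub1_neq0 1).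
Qed.

Lemma diag2_involution_mx2 : diag2 1 (-1) = mx2 1 0 0 (-1) :> 'M[F]_2.
Proof. by apply: mx2P; rewrite !mxE. Qed.

Lemma trsum_QsQ r t n : n = (r + t).+1 ->
  trsum psi (QsQ eps n r) = - (coset_coef r t * kloosterman_GL psi t * K).
Proof.
move=> ->; have := @trsum_double_coset r t 1%:M.
rewrite trmx1 mul1mx !mulmx1 => /(_ erefl erefl) h.
have e : \sum_(i in SOm2 eps) psi (\tr (1%:M *m i)) = - K.
  rewrite -(sum_psi_SOm2 two_neq0 eps_nonsquare psi0 psiD psi_nt).
  by apply: eq_bigr => i _; rewrite mul1mx.
rewrite e mulrN in h.
rewrite -h /trsum; apply: eq_bigl => w; rewrite /QsQ sigmaE.
have t1 : tailmx (r + t) 1%:M = 1%:M :> 'M[F]_(r + t + (r + t) + 2).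
  by rewrite /tailmx -scalar_mx_block.
by apply/imset2P/imset2P => -[x y xQ yQ ->]; exists x y => //; rewrite t1 mul1mx.
Qed.

Lemma trsum_rQsQ r t n : n = (r + t).+1 ->
  trsum psi (rQsQ eps n r) = coset_coef r t * kloosterman_GL psi t * (q + 1).
Proof.
move=> ->; have := @trsum_double_coset r t (diag2 1 (-1)).
have dd : diag2 1 (-1) *m diag2 1 (-1) = 1%:M :> 'M[F]_2.
  by rewrite diag2_involution_mx2 mul_mx2 -mx2_1; congr mx2; ring.
have hd : (diag2 1 (-1))^T *m delta eps *m diag2 1 (-1) = delta eps.
  by rewrite diag2_involution_mx2 delta_mx2 tr_mx2 !mul_mx2; congr mx2; ring.
move=> /(_ hd dd) h.
rewrite -(card_SOm2 two_neq0 eps_nonsquare).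
have -> : \sum_(i in SOm2 eps) 1 = \sum_(i in SOm2 eps) psi (\tr (diag2 1 (-1) *m i)).
  by apply: eq_bigr => i /tr_diag_SOm2 ->; rewrite psi0.
by rewrite -h /trsum /rQsQ sigmaE.
Qed.

Lemma divn4_eq a b : a = (b * 4)%N -> (a %/ 4)%N = b.
Proof. by move=> ->; rewrite mulnK. Qed.

Lemma sign_even k : (-1) ^+ k.*2 = 1 :> algC.
Proof. by rewrite -signr_odd odd_double. Qed.

Lemma sign_odd k : (-1) ^+ k.*2.+1 = -1 :> algC.
Proof. by rewrite exprS sign_even mulr1. Qed.

Lemma oddprodS k : oddprod q k.+1 = oddprod q k * (q ^+ k.*2.+1 - 1).
Proof. by rewrite /oddprod big_nat_recr //= mulnC muln2 doubleS subn1. Qed.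

(** Here n = 2k + 2 and r = n - 1. The last factor of the odd product for r is the separate factor
    q^(n-1) - 1 of [A1p]. *)
Lemma coset_coef0_odd k : coset_coef k.*2.+1 0 = - A1p k.*2.+2 q.
Proof.
rewrite coset_coef0 sign_odd mulN1r (sym_countE F k).2 oddprodS /A1p bin2_odd; congr (- _).
rewrite -mulnn (@divn4_eq _ (5 * k * k + 9 * k + 3)); last by rewrite -muln2; lia.
have -> : ((k.*2.+2 - 2) %/ 2 = k)%N by lia.
rewrite subn1 /=.
have -> : (5 * k * k + 9 * k + 3 = 2 * k.*2.+1 + k.*2.+1 * k + k.*2.+1 * k + k.*2.+1 + k * k.+1)%N.
  by rewrite -muln2; lia.
rewrite !exprD; ring.
Qed.

Lemma coset_coef1_even k : coset_coef k.*2 1 = A2p k.*2.+2 q.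
Proof.
rewrite coset_coef1 sign_even mul1r (sym_countE F k).1 /A2p bin2_odd bin2_even.
rewrite -mulnn (@divn4_eq _ (5 * k * k + 9 * k + 2)); last by rewrite -muln2; lia.
have -> : ((k.*2.+2 - 2) %/ 2 = k)%N by lia.
rewrite subn1 /=.
have -> : (5 * k * k + 9 * k + 2 =
    k.*2 + 2 * k.*2.+1 + k.*2.+1 * k + k * k.*2.-1 + k.*2 + k * k.+1)%N.
  (* The predecessor is truncated at k = 0, where the factor k makes the product vanish anyway. *)
  by rewrite -muln2; case: k => [|k] /=; lia.
rewrite !exprD; ring.
Qed.

(** The inverse of q appears because [A4p] is normalised against K^2 + q^2 - q, whereas the sum over
    GL(2,q) is q times that. *)
Lemma coset_coef2_odd k :
  coset_coef k.*2.+1 2 * (q + 1) = - (q^-1 * A4p k.*2.+4 q).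
Proof.
rewrite coset_coef2 sign_odd (sym_countE F k).2 /A4p -doubleS bin2_odd bin2_odd.
rewrite -mulnn (@divn4_eq _ (5 * k * k + 17 * k + 13)); last by rewrite -muln2; lia.
have -> : ((k.+1.*2.+2 - 2) %/ 2 = k.+1)%N by lia.
rewrite subn1 /=.
have -> : (5 * k * k + 17 * k + 13 =
    (2 * k.*2.+1 + 2 * k.+1.*2.+1 + k.+1.*2.+1 * k.+1 + k.*2.+1 * k + k.*2.+1 + k * k.+1).+1)%N.
  by rewrite -!muln2; lia.
rewrite exprS !exprD; field.
exact: q_neq0.
Qed.

Lemma coset_coef0_even k : coset_coef k.*2 0 = A1m k.*2.+1 q.
Proof.
rewrite coset_coef0 sign_even mul1r (sym_countE F k).1 /A1m bin2_even.
rewrite -mulnn (@divn4_eq _ (5 * k * k + 5 * k)); last by rewrite -muln2; lia.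
have -> : ((k.*2.+1 - 1) %/ 2 = k)%N by lia.
have -> : (5 * k * k + 5 * k = 2 * k.*2 + k * k.*2.-1 + k * k.*2.-1 + k.*2 + k * k.+1)%N.
  by rewrite -muln2; case: k => [|k] /=; lia.
rewrite !exprD; ring.
Qed.

Lemma coset_coef1_odd k : coset_coef k.*2.+1 1 = - A2m k.*2.+3 q.
Proof.
rewrite coset_coef1 sign_odd mulN1r (sym_countE F k).2 /A2m -doubleS bin2_even bin2_odd.
rewrite -mulnn (@divn4_eq _ (5 * k * k + 13 * k + 7)); last by rewrite -muln2; lia.
have -> : ((k.+1.*2.+1 - 1) %/ 2 = k.+1)%N by lia.
rewrite subn1 /=; congr (- _).
have -> : (5 * k * k + 13 * k + 7 = k.*2.+1 + 2 * k.+1.*2 + k.+1 * k.*2.+1 +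
    k.*2.+1 * k + k.*2.+1 + k * k.+1)%N.
  by rewrite -!muln2; lia.
rewrite !exprD; ring.
Qed.

Lemma coset_coef2_even k :
  coset_coef k.*2 2 * (q + 1) = q^-1 * A4m k.*2.+3 q.
Proof.
rewrite coset_coef2 sign_even mul1r (sym_countE F k).1 /A4m -doubleS !bin2_even.
rewrite -mulnn (@divn4_eq _ (5 * k * k + 13 * k + 6)); last by rewrite -muln2; lia.
have -> : ((k.+1.*2.+1 - 3) %/ 2 = k)%N by lia.
rewrite subn1 /=.
have -> : (5 * k * k + 13 * k + 6 =
    (2 * k.*2 + 2 * k.+1.*2 + k.+1 * k.*2.+1 + k * k.*2.-1 + k.*2 + k * k.+1).+1)%N.
  by rewrite -!muln2; case: k => [|k] /=; lia.
rewrite exprS !exprD; field.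
exact: q_neq0.
Qed.
End Assembly.

Theorem theorem4 (F : finFieldType) (s : nat) (hq : #|F| = (3 ^ s)%N)
  (eps : F) (heps : ~~ [exists x : F, x * x == eps])
  (psi : F -> algC) (psi0 : psi 0 = 1)
  (psiD : forall x y : F, psi (x + y) = psi x * psi y)
  (psi_nt : exists x : F, psi x != 1) :
  let q : algC := (#|F|)%:R in
  let K := Kl psi 1 in
  (forall n : nat, ~~ odd n -> (2 <= n)%N ->
     [/\ trsum psi (DC1 eps n) = A1p n q * K,
         trsum psi (DC3 eps n) = A3p n q * K,
         trsum psi (DC2 eps n) = - (A2p n q * K ^+ 2) &
         ((4 <= n)%N ->
            trsum psi (DC4 eps n) = - (q^-1 * A4p n q * KGL psi 1) /\
            q^-1 * A4p n q * KGL psi 1 = A4p n q * (K ^+ 2 + q ^+ 2 - q))])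
  /\
  (forall n : nat, odd n ->
     trsum psi (DC1 eps n) = - (A1m n q * K) /\
     ((3 <= n)%N ->
       [/\ trsum psi (DC3 eps n) = - (A3m n q * K),
           trsum psi (DC2 eps n) = A2m n q * K ^+ 2,
           trsum psi (DC4 eps n) = q^-1 * A4m n q * KGL psi 1 &
           q^-1 * A4m n q * KGL psi 1 = A4m n q * (K ^+ 2 + q ^+ 2 - q)])).
Proof.
move=> q K.
have two_neq0 : 2%:R != 0 :> F by apply: odd_card_two_neq0; rewrite hq oddX orbT.
have nsq x : x * x != eps by move/existsPn: heps; apply.
have head := trsum_QsQ two_neq0 nsq psi0 psiD psi_nt.
have tail := trsum_rQsQ two_neq0 nsq psi0 psiD psi_nt.
have KGLE a : q^-1 * a * KGL psi 1 = a * (K ^+ 2 + q ^+ 2 - q).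
  by rewrite (KGL2 psi0 psiD psi_nt) -/q -/K; field; exact: q_neq0.
split=> n n_parity.
  move=> n2; have [k ->] : exists k, n = k.*2.+2 by exists (n./2.-1); lia.
  split.
  (* The pair (r, t) is (n-1, 0) for [DC1], (n-2, 1) for [DC2] and [DC3], and (n-3, 2) for [DC4]. *)
  - rewrite /DC1 (head k.*2.+1 0%N) ?addn0 // coset_coef0_odd // kloosterman_GL0 // -/q -/K; ring.
  - rewrite /DC3 subn2 (tail k.*2 1%N) ?addn1 // coset_coef1_even //.
    rewrite kloosterman_GL1 -/q -/K /A3p; ring.
  - rewrite /DC2 subn2 (head k.*2 1%N) ?addn1 // coset_coef1_even // kloosterman_GL1 -/q -/K; ring.
  (* The bound n >= 4 excludes k = 0; after the shift n = 2k + 4, so r = n - 3 is odd. *)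
  case: k => [//|k] _; rewrite doubleS; split=> //.
  rewrite /DC4 (_ : _ - 3 = k.*2.+1)%N; last by lia.
  by rewrite (tail k.*2.+1 2%N) ?addn2 // mulrAC coset_coef2_odd // kloosterman_GL2 mulNr.
have [k ->] : exists k, n = k.*2.+1 by exists n./2; lia.
split.
  by rewrite /DC1 (head k.*2 0%N) ?addn0 // coset_coef0_even // kloosterman_GL0 // mulr1.
case: k => [//|k] _; rewrite doubleS; split=> //.
- rewrite /DC3 subn2 (tail k.*2.+1 1%N) ?addn1 // coset_coef1_odd //.
  rewrite kloosterman_GL1 -/q -/K /A3m; ring.
- rewrite /DC2 subn2 (head k.*2.+1 1%N) ?addn1 // coset_coef1_odd // kloosterman_GL1 -/q -/K; ring.
rewrite /DC4 (_ : _ - 3 = k.*2)%N; last by lia.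
by rewrite (tail k.*2 2%N) ?addn2 // mulrAC coset_coef2_even // kloosterman_GL2.
Qed.
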